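(* Let $\mathcal{C}(\mathcal{Z})$ be the discrete cluster category associated to an admissible subset $\mathcal{Z}\subseteq S^1$. The set of t-structures of $\mathcal{C}(\mathcal{Z})$ forms a lattice under inclusion of aisles. The meet of two t-structures is given by the intersection of aisles, i.e. the meet of the t-structures with aisles $\mathcal{X}$ and $\mathcal{X}'$ is the t-structure with aisle $\mathcal{X}\cap\mathcal{X}'$.
   Context: **Combinatorial setting.** $\mathbb{K}$ is a field. $S^1$ is the unit circle with anti-clockwise cyclic order: for pairwise distinct $x,y,z\in S^1$, $x<y<z$ means that going anti-clockwise one meets first $x$, then $y$, then $z$; for $m\ge 3$, $x_1<\dots<x_m$ means $x_i<x_{i+1}<x_{i+2}$ for all $i$ (indices modulo $m$). $\mathcal{Z}\subseteq S^1$ is admissible: discrete, infinite, with set of limit points $L(\mathcal{Z})=\overline{\mathcal{Z}}\setminus\mathcal{Z}$ ($\overline{\mathcal{Z}}$ the topological closure) finite of cardinality $n\geq 1$, every limit point being a two-sided limit point. Each $z\in\mathcal{Z}$ has an immediate successor $z^+$ and predecessor $z^-$ in $\mathcal{Z}$ (anti-clockwise, resp. clockwise neighbour). An arc of $\mathcal{Z}$ is a 2-element subset $\{z_0,z_1\}\subseteq\mathcal{Z}$ with $z_1\notin\{z_0^-,z_0,z_0^+\}$. Arcs $\{y_0,y_1\},\{y_0',y_1'\}$ cross if $y_0<y_0'<y_1<y_1'$ or $y_0<y_1'<y_1<y_0'$. **The category.** $\mathcal{C}(\mathcal{Z})$ is the discrete cluster category of Igusa–Todorov: a $\mathbb{K}$-linear,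 2-Calabi–Yau, Krull–Schmidt triangulated category with suspension $\Sigma$ whose non-zero indecomposable objects correspond to arcs of $\mathcal{Z}$ (same notation for arc and object), with: - $\Sigma\{y_0,y_1\}=\{y_0^-,y_1^-\}$; - $\mathrm{Hom}(\{y_0,y_1\},\Sigma\{y_0',y_1'\})=\mathbb{K}$ if the arcs $\{y_0,y_1\}$ and $\{y'_0,y'_1\}$ cross, and $0$ otherwise; - a non-zero morphism $\{y_0,y_1\}\to\{y_0',y_1'\}$ with $y_0<y_0'^+<y_1<y_1'^+$ factors through an indecomposable $S$ iff $S=\{s_0,s_1\}$ with $y_0\le s_0\le y_0'$ and $y_1\le s_1\le y_1'$; - if $y_0<y_0'<y_1<y_1'$, every non-zero $f:\{y_0,y_1\}\to\Sigma\{y_0',y_1'\}$ sits in a triangle $\{y_0',y_1'\}\to X\oplus Z\to\{y_0,y_1\}\xrightarrow{f}\Sigma\{y_0',y_1'\}$ with $X=\{y_0,y_0'\}$, $Z=\{y_1,y_1'\}$ (read as $0$ when not an arc); the components of the first two maps to and from $X$, $Z$ are non-zero when the corresponding objects are non-zero. All subcategories are full and closed under direct sums and summands. **t-structures.** A torsion pair in a triangulated category $\mathcal{T}$ is a pair $(\mathcal{X},\mathcal{Y})$ of subcategories closed under direct summands with $\mathrm{Hom}(X,Y)=0$ for $X\in\mathcal{X},Y\in\mathcal{Y}$ and such that every $T\in\mathcal{T}$ has a distinguished triangle $X\to T\to Y\to\Sigma X$ with $X\in\mathcal{X},Y\in\mathcal{Y}$. A t-structure is a torsion pair with $\Sigma\mathcal{X}\subseteq\mathcal{X}$;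 $\mathcal{X}$ is its aisle, $\mathcal{Y}=\mathcal{X}^\perp$ its coaisle. A t-structure is determined by its aisle. The partial order is $(\mathcal{X},\mathcal{Y})\le(\mathcal{X}',\mathcal{Y}')$ iff $\mathcal{X}\subseteq\mathcal{X}'$. *)

(* Defs.v *)
From mathcomp Require Import all_boot all_order all_algebra.
From mathcomp Require Import all_classical all_reals all_analysis.

Set Implicit Arguments.
Unset Strict Implicit.
Unset Printing Implicit Defensive.

Import Order.TTheory GRing.Theory Num.Theory.
Import numFieldNormedType.Exports.

Local Open Scope classical_set_scope.
Local Open Scope ring_scope.

Definition plane (R : realType) : Type := (R * R)%type.

Section Circle.
Variable R : realType.
Implicit Types (x y z : plane R) (Z : set (plane R)).

Definition circle : set (plane R) := [set p | p.1 ^+ 2 + p.2 ^+ 2 = 1].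

Definition cis (t : R) : plane R := (cos t, sin t).

Definition ccw x y z : Prop :=
  exists a b c : R,
    [/\ a < b, b < c & c < a + pi *+ 2] /\ [/\ x = cis a, y = cis b & z = cis c].

Definition ccw4 x1 x2 x3 x4 : Prop :=
  [/\ ccw x1 x2 x3, ccw x2 x3 x4, ccw x3 x4 x1 & ccw x4 x1 x2].

(* [x <= s <= y], i.e. s lies on the closed anti-clockwise arc from x to y;
   this arc is reduced to the point x when x = y. *)
Definition between x s y : Prop := [\/ s = x, s = y | ccw x s y].

Definition limit_points Z : set (plane R) := closure Z `\` Z.

(* The open circular arcs from l to p <> l (resp. from p <> l to l) are the
   one-sided punctured neighbourhoods of l. *)
Definition two_sided_limit Z (l : plane R) : Prop :=
  forall p, circle p -> p <> l ->
    (exists2 z, Z z & ccw l z p) /\ (exists2 z, Z z & ccw p z l).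

Definition admissible Z : Prop :=
  [/\ Z `<=` circle, Z `<=` isolated Z, infinite_set Z,
      finite_set (limit_points Z) /\ limit_points Z !=set0
    & forall l, limit_points Z l -> two_sided_limit Z l].

Definition is_succ Z z w : Prop :=
  [/\ Z w, w <> z & forall u, Z u -> ~ ccw z u w].

Definition is_pred Z z w : Prop :=
  [/\ Z w, w <> z & forall u, Z u -> ~ ccw w u z].

(* When Z is admissible, every z in Z has exactly one successor and exactly one
   predecessor, so the default value z below is not used. *)
Definition zsucc Z z : plane R := xget z [set w | is_succ Z z w].
Definition zpred Z z : plane R := xget z [set w | is_pred Z z w].

Definition is_arc Z (A : set (plane R)) : Prop :=
  exists z0 z1, [/\ Z z0, Z z1, A = [set z0; z1]
                  & [/\ z1 <> zpred Z z0, z1 <> z0 & z1 <> zsucc Z z0]].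

Definition crosses y0 y1 y0' y1' : Prop :=
  ccw4 y0 y0' y1 y1' \/ ccw4 y0 y1' y1 y0'.

End Circle.

Record linear_category (K : fieldType) := LinearCategory {
  obj :> Type;
  hom : obj -> obj -> lmodType K;
  idm : forall X, hom X X;
  compm : forall X Y Z, hom Y Z -> hom X Y -> hom X Z;
  comp1m : forall X Y (f : hom X Y), compm (idm Y) f = f;
  compm1 : forall X Y (f : hom X Y), compm f (idm X) = f;
  compmA : forall W X Y Z (h : hom Y Z) (g : hom X Y) (f : hom W X),
    compm h (compm g f) = compm (compm h g) f;
  compm_linear_r : forall X Y Z (g : hom Y Z), linear (@compm X Y Z g);
  compm_linear_l : forall X Y Z (f : hom X Y),
    linear (fun g : hom Y Z => compm g f)
}.

Arguments hom {K l} X Y.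
Arguments idm {K l} X.
Arguments compm {K l X Y Z} g f.

Notation "g '\oc' f" := (compm g f) (at level 50, left associativity,
  format "g  '\oc'  f").

Section LinearCategory.
Variables (K : fieldType) (C : linear_category K).

Definition is_iso (X Y : C) (f : hom X Y) : Prop :=
  exists2 g : hom Y X, g \oc f = idm X & f \oc g = idm Y.

Definition isomorphic (X Y : C) : Prop := exists f : hom X Y, is_iso f.

Definition is_zero (X : C) : Prop := idm X = 0.

(* X is the biproduct of the finite family Y; for I empty, X is a zero
   object. *)
Definition is_biproduct (I : finType) (Y : I -> C) (X : C)
    (inc : forall i, hom (Y i) X) (prj : forall i, hom X (Y i)) : Prop :=
  [/\ forall i, prj i \oc inc i = idm (Y i),
      forall i j, i <> j -> prj j \oc inc i = 0
    & \sum_i (inc i \oc prj i) = idm X].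

Definition direct_sum (I : finType) (Y : I -> C) (X : C) : Prop :=
  exists inc prj, @is_biproduct I Y X inc prj.

Definition additive_category : Prop :=
  forall (I : finType) (Y : I -> C), exists X, direct_sum Y X.

Definition indecomposable (X : C) : Prop :=
  ~ is_zero X /\
  forall Y : bool -> C, direct_sum Y X -> exists b, is_zero (Y b).

Definition local_end (X : C) : Prop :=
  ~ is_zero X /\ forall e : hom X X, is_iso e \/ is_iso (idm X - e).

Definition krull_schmidt : Prop :=
  forall X : C, exists (I : finType) (Y : I -> C),
    direct_sum Y X /\ forall i, local_end (Y i).

Definition factors_through (X Y : C) (f : hom X Y) (S : C) : Prop :=
  exists (g : hom X S) (h : hom S Y), f = h \oc g.

(* A full subcategory closed under finite direct sums and direct summands; the
   case of one-element families gives closure under isomorphism. *)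
Definition subcategory (S : set C) : Prop :=
  forall (I : finType) (Y : I -> C) (X : C), direct_sum Y X ->
    (S X <-> forall i, S (Y i)).

End LinearCategory.

(* The suspension is only required to be an autoequivalence. *)
Record triangulated_category (K : fieldType) := TriangulatedCategory {
  tcat :> linear_category K;
  tcat_additive : additive_category tcat;
  susp : tcat -> tcat;
  suspm : forall X Y : tcat, hom X Y -> hom (susp X) (susp Y);
  suspm1 : forall X, suspm (idm X) = idm (susp X);
  suspmM : forall (X Y Z : tcat) (g : hom Y Z) (f : hom X Y),
    suspm (g \oc f) = suspm g \oc suspm f;
  suspm_linear : forall X Y, linear (@suspm X Y);
  suspm_bij : forall X Y, bijective (@suspm X Y);
  susp_ess_surj : forall Y, exists X, isomorphic (susp X) Y;
  (* [dist u v w]: X -u-> Y -v-> Z -w-> susp X is a distinguished triangle *)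
  dist : forall X Y Z : tcat, hom X Y -> hom Y Z -> hom Z (susp X) -> Prop;
  dist_iso : forall (X Y Z X' Y' Z' : tcat)
      (u : hom X Y) (v : hom Y Z) (w : hom Z (susp X))
      (u' : hom X' Y') (v' : hom Y' Z') (w' : hom Z' (susp X'))
      (a : hom X X') (b : hom Y Y') (c : hom Z Z'),
    is_iso a -> is_iso b -> is_iso c ->
    b \oc u = u' \oc a -> c \oc v = v' \oc b -> suspm a \oc w = w' \oc c ->
    dist u v w -> dist u' v' w';
  dist_id : forall X O : tcat, is_zero O ->
    dist (idm X) (0 : hom X O) (0 : hom O (susp X));
  dist_cone : forall (X Y : tcat) (u : hom X Y),
    exists (Z : tcat) (v : hom Y Z) (w : hom Z (susp X)), dist u v w;
  dist_rot : forall (X Y Z : tcat)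
      (u : hom X Y) (v : hom Y Z) (w : hom Z (susp X)),
    dist u v w <-> dist v w (- suspm u);
  dist_morphism : forall (X Y Z X' Y' Z' : tcat)
      (u : hom X Y) (v : hom Y Z) (w : hom Z (susp X))
      (u' : hom X' Y') (v' : hom Y' Z') (w' : hom Z' (susp X'))
      (a : hom X X') (b : hom Y Y'),
    dist u v w -> dist u' v' w' -> b \oc u = u' \oc a ->
    exists2 c : hom Z Z', c \oc v = v' \oc b & suspm a \oc w = w' \oc c;
  dist_octahedron : forall (X Y Z Q1 Q2 Q3 : tcat) (f : hom X Y) (g : hom Y Z)
      (p1 : hom Y Q1) (d1 : hom Q1 (susp X))
      (p2 : hom Z Q2) (d2 : hom Q2 (susp X))
      (p3 : hom Z Q3) (d3 : hom Q3 (susp Y)),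
    dist f p1 d1 -> dist (g \oc f) p2 d2 -> dist g p3 d3 ->
    exists (a : hom Q1 Q2) (b : hom Q2 Q3),
      [/\ dist a b (suspm p1 \oc d3),
          a \oc p1 = p2 \oc g, d2 \oc a = d1,
          b \oc p2 = p3 & d3 \oc b = suspm f \oc d2]
}.

Arguments susp {K t} X.
Arguments suspm {K t X Y} f.
Arguments dist {K t X Y Z} u v w.

(* Hom(X, Y) is isomorphic to the dual of Hom(Y, susp^2 X), naturally in X and
   Y; the isomorphism is f |-> beta f. *)
Definition calabi_yau2 (K : fieldType) (C : triangulated_category K) : Prop :=
  exists beta : forall X Y : C, hom X Y -> hom Y (susp (susp X)) -> K^o,
    [/\ forall X Y (f : hom X Y), linear (beta X Y f),
        forall X Y g, linear (fun f : hom X Y => beta X Y f g),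
        forall X Y (phi : {linear hom Y (susp (susp X)) -> K^o}),
          exists! f : hom X Y, forall g, beta X Y f g = phi g,
        forall X X' Y (a : hom X' X) (f : hom X Y) g,
          beta X' Y (f \oc a) g = beta X Y f (suspm (suspm a) \oc g)
      & forall X Y Y' (b : hom Y Y') (f : hom X Y) g,
          beta X Y' (b \oc f) g = beta X Y f (g \oc b)].

(* [M A] is the indecomposable object attached to the arc A; by convention it
   is a zero object when A is not an arc of Z. *)
Record discrete_cluster_category (K : fieldType) (R : realType)
    (Z : set (plane R)) (C : triangulated_category K)
    (M : set (plane R) -> C) : Prop := DiscreteClusterCategory {
  dcc_calabi_yau2 : calabi_yau2 C;
  dcc_krull_schmidt : krull_schmidt C;
  dcc_indecomposable : forall A, is_arc Z A -> indecomposable (M A);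
  dcc_inj : forall A B, is_arc Z A -> is_arc Z B ->
    isomorphic (M A) (M B) -> A = B;
  dcc_surj : forall X : C, indecomposable X ->
    exists2 A, is_arc Z A & isomorphic X (M A);
  dcc_not_arc : forall A, ~ is_arc Z A -> is_zero (M A);
  dcc_susp : forall y0 y1, is_arc Z [set y0; y1] ->
    isomorphic (susp (M [set y0; y1])) (M [set zpred Z y0; zpred Z y1]);
  dcc_hom_cross : forall y0 y1 y0' y1',
    is_arc Z [set y0; y1] -> is_arc Z [set y0'; y1'] ->
    crosses y0 y1 y0' y1' ->
    exists phi : {linear hom (M [set y0; y1]) (susp (M [set y0'; y1'])) -> K^o},
      bijective phi;
  dcc_hom_ncross : forall y0 y1 y0' y1',
    is_arc Z [set y0; y1] -> is_arc Z [set y0'; y1'] ->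
    ~ crosses y0 y1 y0' y1' ->
    forall f : hom (M [set y0; y1]) (susp (M [set y0'; y1'])), f = 0;
  dcc_factor : forall y0 y1 y0' y1',
    is_arc Z [set y0; y1] -> is_arc Z [set y0'; y1'] ->
    ccw4 y0 (zsucc Z y0') y1 (zsucc Z y1') ->
    forall f : hom (M [set y0; y1]) (M [set y0'; y1']), f <> 0 ->
    forall S : C, indecomposable S ->
      factors_through f S <->
      exists s0 s1, [/\ Z s0, Z s1, isomorphic S (M [set s0; s1]),
                        between y0 s0 y0' & between y1 s1 y1'];
  dcc_triangle : forall y0 y1 y0' y1',
    is_arc Z [set y0; y1] -> is_arc Z [set y0'; y1'] ->
    ccw4 y0 y0' y1 y1' ->
    forall f : hom (M [set y0; y1]) (susp (M [set y0'; y1'])), f <> 0 ->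
    let XZ (b : bool) : C := if b then M [set y0; y0'] else M [set y1; y1'] in
    exists (W : C) (inc : forall b, hom (XZ b) W) (prj : forall b, hom W (XZ b))
           (u : hom (M [set y0'; y1']) W) (v : hom W (M [set y0; y1])),
      [/\ is_biproduct inc prj, dist u v f
        & forall b, ~ is_zero (XZ b) -> prj b \oc u <> 0 /\ v \oc inc b <> 0]
}.

Section TStructures.
Variables (K : fieldType) (C : triangulated_category K).

Definition torsion_pair (X Y : set C) : Prop :=
  [/\ subcategory X, subcategory Y,
      forall A B, X A -> Y B -> forall f : hom A B, f = 0
    & forall T : C, exists (A B : C) (u : hom A T) (v : hom T B)
                           (w : hom B (susp A)), [/\ X A, Y B & dist u v w]].

Record t_structure := TStructure {
  aisle : set C;
  coaisle : set C;
  t_structure_torsion_pair : torsion_pair aisle coaisle;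
  t_structure_susp : forall A, aisle A -> aisle (susp A)
}.

Definition t_structure_le (T T' : t_structure) : Prop := aisle T `<=` aisle T'.

End TStructures.

Section Lattice.
Variables (T : Type) (le : T -> T -> Prop).

Definition is_meet (x y m : T) : Prop :=
  [/\ le m x, le m y & forall z, le z x -> le z y -> le z m].

Definition is_join (x y j : T) : Prop :=
  [/\ le x j, le y j & forall z, le x z -> le y z -> le j z].

Definition is_partial_order : Prop :=
  [/\ forall x, le x x,
      forall x y, le x y -> le y x -> x = y
    & forall x y z, le x y -> le y z -> le x z].

Definition is_lattice : Prop :=
  [/\ is_partial_order,
      forall x y, exists m, is_meet x y m
    & forall x y, exists j, is_join x y j].

End Lattice.

(* Main.v *)
(* A subcategory V that is closed under extensions and suspension is determined
   by its arcs, and when two arcs of V cross, the four sides of the quadrilateral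
   they span are in V.  Cut Z at its limit points into finitely many segments,
   each ordered like the integers.  It follows that the ends in a segment of the
   arcs of V form a down-set, and that V induces an equivalence relation on the
   segments that it meets, two ends spanning an arc of V if and only if their
   segments are equivalent.  Such a V gives right approximations, hence is an
   aisle, if and only if, whenever the ends exhaust a segment towards its upper
   limit point, some arc of V joins this segment to the next one: the arcs of V
   mapping to a given arc are then dominated by finitely many of them.

   This condition passes to the intersection of two aisles.  For the join of X
   and X', take the intersection J of all aisles containing both.  One of these
   is the aisle W of the objects all of whose ends are ends of X or X'; thus if
   the ends of J exhaust a segment, so do those of X or X', which provides an
   arc joining this segment to the next one in X or X', hence in J. *)

Require Import Defs.
From mathcomp Require Import all_boot all_order all_algebra.
From mathcomp Require Import all_classical all_reals all_analysis.
From mathcomp Require Import ring lra.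
Require Import Defs.

Set Implicit Arguments.
Unset Strict Implicit.
Unset Printing Implicit Defensive.

Import Order.TTheory GRing.Theory Num.Theory.
Import numFieldNormedType.Exports.

Local Open Scope classical_set_scope.
Local Open Scope ring_scope.

(** * Linear categories *)

(** The approximations built from arcs are finite sums: every map from V factors through them, but
    not uniquely, so they are not yet truncations. Uniqueness is gained by splitting an idempotent
    of the approximation. As Krull-Schmidt only provides decompositions into objects with local
    endomorphisms, the splitting of idempotents is itself derived from it. On the side of arcs, the
    cyclic order is replaced by angles from a base point. Based at a limit point, the successor
    always increases the angle, and crossings become linear inequalities. A supremum of angles over
    points of Z is either attained or belongs to a limit point; maxima are obtained by excluding the
    second case. Two arcs with a common end do not cross. Lowering that end by one step, by
    suspension or inside its segment, produces a crossing, and the wanted arc is a side of the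
    quadrilateral. *)

Section LinearCategories.
Variables (K : fieldType) (C : linear_category K).
Implicit Types X Y Z : C.

Lemma compDr X Y Z (g : hom Y Z) (f f' : hom X Y) :
  g \oc (f + f') = (g \oc f) + (g \oc f').
Proof. by have := @compm_linear_r _ _ X Y Z g 1 f f'; rewrite !scale1r. Qed.

Lemma compDl X Y Z (g g' : hom Y Z) (f : hom X Y) :
  (g + g') \oc f = (g \oc f) + (g' \oc f).
Proof. by have := @compm_linear_l _ _ X Y Z f 1 g g'; rewrite !scale1r. Qed.

Lemma comp0r X Y Z (g : hom Y Z) : g \oc (0 : hom X Y) = 0.
Proof. by apply: (addrI (g \oc 0)); rewrite -compDr !addr0. Qed.

Lemma comp0l X Y Z (f : hom X Y) : (0 : hom Y Z) \oc f = 0.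
Proof. by apply: (addrI (0 \oc f)); rewrite -compDl !addr0. Qed.

Lemma compNr X Y Z (g : hom Y Z) (f : hom X Y) : g \oc (- f) = - (g \oc f).
Proof. by apply/eqP; rewrite -addr_eq0 -compDr addNr comp0r. Qed.

Lemma compNl X Y Z (g : hom Y Z) (f : hom X Y) : (- g) \oc f = - (g \oc f).
Proof. by apply/eqP; rewrite -addr_eq0 -compDl addNr comp0l. Qed.

Lemma compBr X Y Z (g : hom Y Z) (f f' : hom X Y) :
  g \oc (f - f') = (g \oc f) - (g \oc f').
Proof. by rewrite compDr compNr. Qed.

Lemma compBl X Y Z (g g' : hom Y Z) (f : hom X Y) :
  (g - g') \oc f = (g \oc f) - (g' \oc f).
Proof. by rewrite compDl compNl. Qed.

Lemma compZr X Y Z a (g : hom Y Z) (f : hom X Y) :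
  g \oc (a *: f) = a *: (g \oc f).
Proof. by have := @compm_linear_r _ _ X Y Z g a f 0; rewrite !addr0 comp0r addr0. Qed.

Lemma compZl X Y Z a (g : hom Y Z) (f : hom X Y) :
  (a *: g) \oc f = a *: (g \oc f).
Proof. by have := @compm_linear_l _ _ X Y Z f a g 0; rewrite !addr0 comp0l addr0. Qed.

Lemma comp_sumr (I : finType) (P : pred I) X Y Z (g : hom Y Z)
    (f : I -> hom X Y) :
  g \oc (\sum_(i | P i) f i) = \sum_(i | P i) (g \oc f i).
Proof.
apply: (big_morph (fun f => g \oc f)); first exact: compDr.
exact: comp0r.
Qed.

Lemma comp_suml (I : finType) (P : pred I) X Y Z (g : I -> hom Y Z)
    (f : hom X Y) :
  (\sum_(i | P i) g i) \oc f = \sum_(i | P i) (g i \oc f).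
Proof.
apply: (big_morph (fun g => g \oc f)) => [g1 g2|]; first exact: compDl.
exact: comp0l.
Qed.

Lemma is_iso_id X : is_iso (idm X).
Proof. by exists (idm X); rewrite comp1m. Qed.

Lemma isomorphic_sym X Y : isomorphic X Y -> isomorphic Y X.
Proof. by case=> f [g gf fg]; exists g, f. Qed.

Lemma isomorphic_refl X : isomorphic X X.
Proof. by exists (idm X); exact: is_iso_id. Qed.

Lemma zero_hom_from X Y (f : hom X Y) : is_zero X -> f = 0.
Proof. by move=> X0; rewrite -(compm1 f) X0 comp0r. Qed.

Lemma direct_sum1 X Y : isomorphic Y X -> direct_sum (fun _ : unit => Y) X.
Proof.
case=> f [g gf fg]; exists (fun _ => f), (fun _ => g); split => //.
  by case; case.
by rewrite (bigD1 tt) //= big1 ?addr0 //; case.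
Qed.

Lemma direct_sum0 (Y : void -> C) X : is_zero X -> direct_sum Y X.
Proof.
move=> X0; exists (fun=> 0), (fun=> 0); split; [by case|by case|].
by rewrite big_pred0 ?X0 //; case.
Qed.

(** Multiplying the decomposition of the identity by [inc b \oc prj b] shows that the two
    idempotents annihilate each other; composing with a projection and an inclusion gives the mixed
    relations. *)
Lemma direct_sum2 (Y : bool -> C) X
    (inc : forall b, hom (Y b) X) (prj : forall b, hom X (Y b)) :
  (forall b, prj b \oc inc b = idm (Y b)) ->
  (inc true \oc prj true) + (inc false \oc prj false) = idm X ->
  is_biproduct inc prj.
Proof.
move=> h1 h2; split => //; last by rewrite big_bool.
have e b : inc b \oc prj b \oc (inc (~~ b) \oc prj (~~ b)) = 0.
  have: (inc b \oc prj b) + (inc (~~ b) \oc prj (~~ b)) = idm X.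
    by case: b => //=; rewrite addrC.
  move/(congr1 (fun h => inc b \oc prj b \oc h)).
  rewrite compDr compm1 {1}compmA -(compmA _ (prj b) (inc b)) h1 compm1.
  by move/(canRL (addKr _)); rewrite addNr.
move=> b b' /eqP; rewrite -[b'](addbK b) addbC.
case: eqVneq => [->|]; rewrite ?eqxx // => ne _.
have -> : b (+) (b' (+) b) = ~~ b by case: b b' ne {e} => [] [].
have /(congr1 (fun h => prj (~~ b) \oc h \oc inc b)) := e (~~ b).
rewrite negbK comp0r comp0l.
rewrite !compmA h1 comp1m -compmA h1 compm1 => <- //.
Qed.

Section Subcategory.
Variable S : set C.
Hypothesis hS : subcategory S.

Lemma subcat_iso X Y : isomorphic X Y -> S X -> S Y.
Proof. by move=> XY SX; apply/(hS (direct_sum1 XY)). Qed.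

Lemma subcat_zero X : is_zero X -> S X.
Proof.
by move=> X0; apply/(hS (direct_sum0 (fun i : void => X) X0)); case.
Qed.

End Subcategory.


(** * Splitting of idempotents *)

Definition splits X (e : hom X X) :=
  exists (A : C) (r : hom X A) (i : hom A X), i \oc r = e /\ r \oc i = idm A.

(** The two products of [x] and [y] are equivalent idempotents: [r \oc y] and [x \oc i] transport
    the splitting from one to the other. *)
Lemma splits_conj X (e x y : hom X X) :
  x \oc y = e -> e \oc e = e -> splits (y \oc x) -> splits e.
Proof.
move=> xy ee [A [r [i [ir ri]]]].
exists A, (r \oc y), (x \oc i); split.
  by rewrite compmA -(compmA _ i) ir compmA xy -compmA xy.
by rewrite compmA -(compmA _ y) -ir compmA ri comp1m ri.
Qed.

Lemma splits_add X (e e' : hom X X) : additive_category C ->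
  e \oc e' = 0 -> e' \oc e = 0 -> splits e -> splits e' -> splits (e + e').
Proof.
move=> addC e1 e2 [A [r [i [ir ri]]]] [A' [r' [i' [ir' ri']]]].
have [B [inc [prj [pi1 pi0 ps]]]] := addC _ (fun b : bool => if b then A else A').
pose it := inc true : hom A B; pose jf := inc false : hom A' B.
pose pt := prj true : hom B A; pose pf := prj false : hom B A'.
have tt : pt \oc it = idm A := pi1 true.
have ff : pf \oc jf = idm A' := pi1 false.
have tf : pt \oc jf = 0 by apply: (pi0 false true).
have ft : pf \oc it = 0 by apply: (pi0 true false).
have r1 : r \oc i' = 0.
  rewrite -[r]comp1m -ri -[i']compm1 -ri' -!compmA (compmA i' r') ir'.
  by rewrite (compmA i r) ir (compmA e e') e1 comp0l comp0r.
have r2 : r' \oc i = 0.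
  rewrite -[r']comp1m -ri' -[i]compm1 -ri -!compmA (compmA i r) ir.
  by rewrite (compmA i' r') ir' (compmA e' e) e2 comp0l comp0r.
exists B, ((it \oc r) + (jf \oc r')), ((i \oc pt) + (i' \oc pf)); split.
  rewrite compDl !compDr -!compmA !(compmA _ it) !(compmA _ jf).
  by rewrite tt tf ft ff !comp1m !comp0l !comp0r addr0 add0r ir ir'.
rewrite compDl !compDr -!compmA !(compmA r) !(compmA r').
rewrite r1 r2 ri ri' !comp1m !comp0l !comp0r addr0 add0r.
by move: ps; rewrite big_bool.
Qed.

(* One step of Gaussian elimination: [a \oc b + p] is the projection onto
   Y (+) im p, and the pivot is an invertible diagonal entry of either e or its
   complement. *)
Lemma splits_pivot X Y (a : hom Y X) (b : hom X Y) (p : hom X X) :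
  additive_category C -> local_end Y ->
  b \oc a = idm Y -> p \oc p = p -> b \oc p = 0 -> p \oc a = 0 ->
  (forall e, e \oc e = e -> p \oc e = e -> e \oc p = e -> splits e) ->
  forall e, e \oc e = e -> ((a \oc b) + p) \oc e = e ->
    e \oc ((a \oc b) + p) = e -> splits e.
Proof.
move=> addC [_ locY] ba pp bp pa IH e ee; set q := _ + p => qe eq.
(* With [w] the inverse of the pivot, [W = a \oc w \oc b] is a generalised inverse passing through
   [Y], so [f \oc W \oc f] splits through [Y]. *)
have pe f : (f : hom X X) \oc f = f -> q \oc f = f -> f \oc q = f ->
    is_iso (b \oc f \oc a) -> exists W, [/\ splits (f \oc W \oc f),
      W \oc f \oc W = W, b \oc f \oc W = b & W \oc f \oc a = a].
  move=> ff qf fq [w wu uw]; exists (a \oc w \oc b); split.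
  - exists Y, (w \oc b \oc f), (f \oc a); split; first by rewrite !compmA.
    by rewrite -compmA (compmA f) ff -compmA (compmA b) wu.
  - rewrite -!compmA (compmA f a) (compmA b (f \oc a)) (compmA b f).
    by rewrite (compmA w) wu comp1m.
  - by rewrite 2!compmA uw comp1m.
  - by rewrite -!compmA (compmA b) wu compm1.
have qq : q \oc q = q.
  rewrite /q !compDl !compDr -!compmA (compmA b a) ba comp1m bp comp0r.
  by rewrite (compmA p a) pa comp0l addr0 add0r pp.
have bq : b \oc q = b by rewrite compDr compmA ba comp1m bp addr0.
have qa : q \oc a = a by rewrite compDl -compmA ba compm1 pa addr0.
have pE : p = q - (a \oc b) by rewrite /q addrC addKr.
have [iso|iso] := locY (b \oc e \oc a).
  (* The pivot of [e] is invertible: [x] is the part of [e] split off through [Y], and the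
     orthogonal remainder [e - x] lies under [p]. *)
  have [W [sp WeW beW Wea]] := pe e ee qe eq iso.
  pose x := e \oc W \oc e.
  have ex : e \oc x = x by rewrite !compmA ee.
  have xe : x \oc e = x by rewrite -compmA ee.
  have xx : x \oc x = x.
    rewrite {1}/x -compmA ex /x !compmA -(compmA e W) -(compmA e).
    by rewrite WeW compmA.
  have abx : a \oc b \oc x = a \oc b \oc e.
    by rewrite /x !compmA -(compmA a b) -(compmA a _ W) beW compmA.
  have xab : x \oc (a \oc b) = e \oc (a \oc b).
    by rewrite /x !compmA -(compmA e W) -(compmA e _ a) Wea.
  have <- : x + (e - x) = e by rewrite addrC subrK.
  apply: splits_add => //.
  - by rewrite compBr xe xx subrr.
  - by rewrite compBl ex xx subrr.
  apply: IH.
  - by rewrite compBl !compBr ee ex xe xx subrr subr0.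
  - by rewrite pE compBl !compBr qe abx {1}/x !compmA qe subrr subr0.
  - by rewrite pE compBr !compBl eq xab {1}/x -!compmA eq subrr subr0 !compmA.
(* Otherwise the pivot of the complement is invertible. Eliminating with it turns [e] into [r],
   whose image lies under [p]; then [e] is equivalent to [r \oc p], which the induction hypothesis
   splits. *)
pose f := q - e.
have ef : e \oc f = 0 by rewrite compBr eq ee subrr.
have fe : f \oc e = 0 by rewrite compBl qe ee subrr.
have ff : f \oc f = f by rewrite {1}/f compBl ef subr0 compBr qq qe.
have qf : q \oc f = f by rewrite compBr qq qe.
have fq : f \oc q = f by rewrite compBl qq eq.
have [|W [_ WfW bfW Wfa]] := pe f ff qf fq.
  by rewrite compBr bq compBl ba.
pose r := e - (f \oc W \oc e).
have pr : p \oc r = r.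
  have abr : a \oc b \oc r = 0.
    rewrite compBr !compmA -(compmA a b f) -(compmA a (b \oc f) W) bfW.
    by rewrite subrr.
  by rewrite pE compBl abr subr0 compBr qe !compmA qf.
have er : e \oc r = e by rewrite compBr ee !compmA ef !comp0l subr0.
have rer : r \oc e = r by rewrite compBl ee -compmA ee.
apply: (@splits_conj _ _ (e \oc p) r) => //; first by rewrite -compmA pr.
rewrite compmA rer; apply: IH.
- rewrite -compmA (compmA p) pr -{1}rer -!compmA (compmA e r).
  by rewrite er compmA rer.
- by rewrite compmA pr.
- by rewrite -compmA pp.
Qed.

(** Induction on the list of local summands that [e] may still meet; for the empty list, [e] is zero
    and splits through a zero object. *)
Lemma krull_schmidt_splits : additive_category C -> krull_schmidt C ->
  forall X (e : hom X X), e \oc e = e -> splits e.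
Proof.
move=> addC KS X e ee; have [I [Y [[inc [prj [h1 h0 hs]]] loc]]] := KS X.
suff H (s : seq I) : uniq s -> forall e, e \oc e = e ->
    (\sum_(i <- s) (inc i \oc prj i)) \oc e = e ->
    e \oc (\sum_(i <- s) (inc i \oc prj i)) = e -> splits e.
  apply: (H (index_enum I)); rewrite ?index_enum_uniq ?ee //.
  - by rewrite hs comp1m.
  - by rewrite hs compm1.
elim: s => [_ {}e {}ee|i s IH] /=.
  rewrite big_nil comp0l => e0 _.
  have [N [ic [pr [_ _]]]] := addC void (fun=> X).
  rewrite big_pred0 => [N0|[]//].
  by exists N, 0, 0; rewrite comp0r comp0l e0.
case/andP => his us {}e {}ee; rewrite !big_cons.
have := IH us; set p := \sum_(j <- s) _ => {}IH.
have bp : prj i \oc p = 0.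
  rewrite /p (big_morph (fun f => prj i \oc f) (compDr _) (comp0r _ _)).
  rewrite big_seq big1 // => j js; rewrite compmA h0 ?comp0l // => ji.
  by move: his; rewrite -ji js.
have pa : p \oc inc i = 0.
  have mD : {morph (fun f : hom X X => f \oc inc i) : f g / f + g}.
    by move=> ? ?; rewrite compDl.
  rewrite /p (big_morph _ mD (comp0l _ _)).
  rewrite big_seq big1 // => j js; rewrite -compmA h0 ?comp0r // => ji.
  by move: his; rewrite ji js.
have pp : p \oc p = p.
  rewrite {2 3}/p (big_morph (fun f => p \oc f) (compDr _) (comp0r _ _)).
  rewrite [LHS]big_seq [RHS]big_seq; apply: eq_bigr => j js; rewrite compmA.
  congr (_ \oc _).
  have mD : {morph (fun f : hom X X => f \oc inc j) : f g / f + g}.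
    by move=> ? ?; rewrite compDl.
  rewrite /p (big_morph _ mD (comp0l _ _)) (bigD1_seq j) //=.
  rewrite -compmA h1 compm1 big1 ?addr0 // => k /eqP kj.
  by rewrite -compmA h0 ?comp0r // => jk; apply: kj.
exact: splits_pivot addC (loc i) (h1 i) pp bp pa IH e ee.
Qed.

End LinearCategories.

(** * Aisles from weak approximations *)

Section TriangulatedCategories.
Variables (K : fieldType) (C : triangulated_category K).
Implicit Types X Y Z S T : C.

Lemma suspm0 X Y : suspm (0 : hom X Y) = 0.
Proof.
have := suspm_linear 1 (0 : hom X Y) 0; rewrite !scale1r addr0 => /eqP.
by rewrite -{1}[suspm 0]addr0 (inj_eq (addrI _)) => /eqP <-.
Qed.

Lemma suspmN X Y (f : hom X Y) : suspm (- f) = - suspm f.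
Proof.
by have := suspm_linear (-1) f 0; rewrite suspm0 !addr0 !scaleN1r.
Qed.

Lemma suspm_inj0 X Y (f : hom X Y) : suspm f = 0 -> f = 0.
Proof. by rewrite -(suspm0 X Y) => /(bij_inj (suspm_bij X Y)). Qed.

Lemma suspm_surj X Y (g : hom (susp X) (susp Y)) : exists f, suspm f = g.
Proof. by have [h _ hK] := suspm_bij X Y; exists (h g). Qed.

Lemma zero_object : exists N : C, is_zero N.
Proof.
case: (tcat_additive (fun i : void => match i return C with end)) => N.
by case=> inc [prj [_ _]]; rewrite big_pred0 => [N0|[]//]; exists N.
Qed.

Lemma susp_zero X : is_zero X -> is_zero (susp X).
Proof. by rewrite /is_zero -suspm1 => ->; rewrite suspm0. Qed.

Section Exactness.
Variables (X Y Z : C) (u : hom X Y) (v : hom Y Z) (w : hom Z (susp X)).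
Hypothesis tr : dist u v w.

Lemma dist_comp0 : v \oc u = 0.
Proof.
have [N N0] := zero_object.
have e : u \oc idm X = u \oc idm X by [].
by have [c <- _] := dist_morphism (dist_id X N0) tr e; rewrite comp0r.
Qed.

Lemma dist_lift S (g : hom S Y) : v \oc g = 0 -> exists h, u \oc h = g.
Proof.
move=> vg; have [N N0] := zero_object.
have /dist_rot t1 := dist_id S N0; move/dist_rot: tr => t2.
have [|c _ e] := dist_morphism t1 t2 (a := g) (b := 0).
  by rewrite comp0l vg.
have [h hc] := suspm_surj c; exists h; move: e.
rewrite suspm1 compNr compm1 compNl -hc -suspmM => /oppr_inj.
by move/(bij_inj (suspm_bij _ _)).
Qed.

Lemma dist_extend T (f : hom X T) : suspm f \oc w = 0 -> exists t, t \oc u = f.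
Proof.
move=> fw; have [N N0] := zero_object.
move/dist_rot/dist_rot: tr => t1.
have t2 : dist (0 : hom N (susp T)) (idm (susp T)) 0.
  by apply/dist_rot; rewrite suspm0 oppr0; apply/dist_id/susp_zero.
have [|c e _] := dist_morphism t1 t2 (a := 0) (b := suspm f).
  by rewrite comp0l fw.
have [t tc] := suspm_surj c; exists (- t); move: e.
rewrite comp1m compNr -tc -suspmM -suspmN => /(bij_inj (suspm_bij _ _)) <-.
by rewrite compNl.
Qed.

End Exactness.

Lemma dist_lift_third X Y Z (u : hom X Y) (v : hom Y Z) (w : hom Z (susp X)) S
    (g : hom S Z) : dist u v w -> w \oc g = 0 -> exists h, v \oc h = g.
Proof. by move=> /dist_rot /dist_lift; apply. Qed.

Lemma dist_comp0_susp X Y Z (u : hom X Y) (v : hom Y Z) (w : hom Z (susp X)) :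
  dist u v w -> suspm u \oc w = 0.
Proof.
move=> /dist_rot /dist_rot /dist_comp0 /eqP.
by rewrite compNl oppr_eq0 => /eqP.
Qed.

(** The triangle on the cone of [w] is rotated back twice. As [susp] is only essentially surjective,
    the cone is first replaced by an isomorphic suspension; the two signs compensate those of
    [dist_rot]. *)
Lemma dist_cocone X Z (w : hom Z (susp X)) :
  exists Y (u : hom X Y) (v : hom Y Z), dist u v w.
Proof.
have [Q [p [d t]]] := dist_cone w.
have [Y [f fiso]] := susp_ess_surj Q; have [g gf fg] := fiso.
have [u hu] := suspm_surj (g \oc p); have [v hv] := suspm_surj (d \oc f).
exists Y, (- u), (- v); apply/dist_rot/dist_rot; rewrite !suspmN !opprK hu hv.
apply: (dist_iso (is_iso_id _) (is_iso_id _) _ _ _ _ t).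
- by exists f; [exact: fg|exact: gf].
- by rewrite comp1m compm1.
- by rewrite compm1.
- by rewrite suspm1 comp1m -compmA fg compm1.
Qed.

Definition ext_closed (V : set C) :=
  forall X Y Z (u : hom X Y) (v : hom Y Z) (w : hom Z (susp X)),
    dist u v w -> V X -> V Z -> V Y.

Definition susp_closed (V : set C) := forall X, V X -> V (susp X).

(* Weak universal property only: [c] need not be minimal. *)
Definition precover (V : set C) X T (c : hom X T) :=
  V X /\ forall S (g : hom S T), V S -> exists h, c \oc h = g.

Definition perp (V : set C) : set C :=
  [set B | forall S, V S -> forall f : hom S B, f = 0].

Lemma perp_subcategory (V : set C) : subcategory (perp V).
Proof.
move=> I Y X [inc [prj [h1 h0 hs]]]; split => [pX i S VS f|pY S VS f].
  by rewrite -(comp1m f) -h1 -compmA (pX _ VS (inc i \oc f)) comp0r.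
rewrite -(comp1m f) -hs comp_suml big1 // => i _.
by rewrite -compmA (pY i _ VS (prj i \oc f)) comp0r.
Qed.

(** * From weak approximations to torsion pairs *)

Section PrecoverTorsion.
Variable V : set C.
Hypotheses (hV : subcategory V) (eV : ext_closed V) (sV : susp_closed V).

(** Let [B] be the cone of an approximation [f], and [g] an approximation of [B]. The extension [E]
    of [A] by [X] along [w \oc g] lies in [V], so the extension of [f] to [E] factors through [f],
    by [k]. If [f] kills a map [h] from [V], then [suspm h] factors through [w \oc g], hence
    [u \oc h = 0]. Thus [e = k \oc u] is an idempotent that kills exactly what has to be removed,
    and [f] restricted to its image is injective on maps from [V]. *)
Lemma precover_coreflection : krull_schmidt C ->
  (forall T, exists X (c : hom X T), precover V c) ->
  forall T, exists X (c : hom X T), precover V c /\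
    forall S (g : hom S X), V S -> c \oc g = 0 -> g = 0.
Proof.
move=> KS hp T; have [X [f [VX hf]]] := hp T.
have [B [v [w t]]] := dist_cone f.
have [A [g [VA hg]]] := hp B.
have [E [u [v' t']]] := dist_cocone (w \oc g).
have VE : V E by apply: eV t' _ _.
have [s su] : exists s, s \oc u = f.
  by apply: (dist_extend t'); rewrite compmA (dist_comp0_susp t) comp0l.
have [k fk] := hf _ s VE.
pose e := k \oc u.
have fe : f \oc e = f by rewrite compmA fk su.
have eker S (h : hom S X) : V S -> f \oc h = 0 -> e \oc h = 0.
  move=> VS fh.
  have [m wm] : exists m, w \oc m = suspm h.
    by move/dist_rot: t => /dist_lift_third; apply;
      rewrite compNl -suspmM fh suspm0 oppr0.
  have [n gn] := hg _ m (sV VS).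
  suff -> : e \oc h = k \oc (u \oc h) by rewrite (_ : u \oc h = 0) ?comp0r //;
    apply: suspm_inj0; rewrite suspmM -wm -gn (compmA w) compmA
      (dist_comp0_susp t') comp0l.
  by rewrite compmA.
have ee : e \oc e = e.
  apply/eqP; rewrite -subr_eq0 -{3}(compm1 e) -compBr; apply/eqP/eker => //.
  by rewrite compBr fe compm1 subrr.
have [Y [r [i [ir ri]]]] := krull_schmidt_splits (@tcat_additive _ C) KS ee.
have [Y' [r' [i' [ir' ri']]]] : splits (idm X - e).
  apply: (krull_schmidt_splits (@tcat_additive _ C) KS).
  by rewrite compBl !compBr !comp1m compm1 ee subrr subr0.
have VY : V Y.
  have bi : direct_sum (fun b : bool => if b then Y else Y') X.
    exists (fun b => match b return hom (if b then Y else Y') X with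
                     | true => i | false => i' end).
    exists (fun b => match b return hom X (if b then Y else Y') with
                     | true => r | false => r' end).
    by apply: direct_sum2; [case|rewrite ir ir' addrC subrK].
  exact: ((hV bi).1 VX true).
exists Y, (f \oc i); split=> [|S h VS].
  split=> // S h VS; have [m fm] := hf _ h VS.
  by exists (r \oc m); rewrite -compmA (compmA i) ir compmA fe.
rewrite -compmA => /(eker _ _ VS).
by rewrite -ir -!compmA (compmA r) ri comp1m => /(congr1 (fun z => r \oc z));
  rewrite comp0r compmA ri comp1m.
Qed.

(** An argument of Wakamatsu type: for [g] from [V] to the cone, the extension [E] along [w \oc g]
    lies in [V], and injectivity of [c] makes [u] a split monomorphism. So [w \oc g = 0], [g] lifts
    to [T], then to [X], and vanishes. *)
Lemma coreflection_torsion_pair :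
  (forall T, exists X (c : hom X T), precover V c /\
    forall S (g : hom S X), V S -> c \oc g = 0 -> g = 0) ->
  torsion_pair V (perp V).
Proof.
move=> hc; split => //; first exact: perp_subcategory.
  by move=> A B VA pB f; apply: pB.
move=> T; have [X [c [[VX cov] inj]]] := hc T.
have [B [v [w t]]] := dist_cone c; exists X, B, c, v, w; split => // S VS g.
have [E [u [q t']]] := dist_cocone (w \oc g).
have VE : V E by apply: eV t' _ _.
have [s su] : exists s, s \oc u = c.
  by apply: (dist_extend t'); rewrite compmA (dist_comp0_susp t) comp0l.
have [k ck] := cov _ s VE.
have ku : k \oc u = idm X.
  apply/eqP; rewrite -subr_eq0; apply/eqP/inj => //.
  by rewrite compBr compmA ck su compm1 subrr.
have wg : w \oc g = 0.
  by rewrite -[LHS]comp1m -suspm1 -ku suspmM -compmA (dist_comp0_susp t') comp0r.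
have [m <-] := dist_lift_third t wg; have [n <-] := cov _ m VS.
by rewrite compmA (dist_comp0 t) comp0l.
Qed.

Lemma precover_t_structure : krull_schmidt C ->
  (forall T, exists X (c : hom X T), precover V c) ->
  exists T : t_structure C, aisle T = V.
Proof.
move=> KS /(precover_coreflection KS) /coreflection_torsion_pair tp.
by exists (TStructure tp sV).
Qed.

End PrecoverTorsion.

Section TStructure.
Variable T : t_structure C.

Lemma aisle_subcategory : subcategory (aisle T).
Proof. by case: T => X Y []. Qed.

(** For [B] in the perpendicular, the map [u] of the truncation triangle is zero. Hence [w] has a
    section from [susp A] to [D]; this section goes from the aisle to the coaisle, so it vanishes
    and [w = 0]. Thus [B] is isomorphic to [D]. *)
Lemma coaisleE : coaisle T = perp (aisle T).
Proof.
case: T => X Y [sX sY h0 ht] sus /=; apply/seteqP; split=> B.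
  by move=> YB S XS f; apply: h0.
move=> pB; have [A [D [u [v [w [XA YD t]]]]]] := ht B.
have u0 : u = 0 by apply: pB.
have [r rv] : exists r, r \oc v = idm B.
  by move/dist_rot: t => /dist_extend; apply; rewrite u0 suspm0 oppr0 comp0r.
have w0 : w = 0.
  have [|h wh] := dist_lift (g := idm (susp A))
    ((dist_rot _ _ _).1 ((dist_rot _ _ _).1 t)).
    by rewrite u0 suspm0 oppr0 comp0l.
  have h00 : h = 0 by apply: h0 => //; apply: sus.
  by rewrite -[w]comp1m -wh h00 comp0r comp0l.
have [|h vh] := dist_lift_third (g := idm D) t; first by rewrite w0 comp0l.
apply: (subcat_iso sY _ YD); exists r, v => //.
suff -> : r = h by [].
by rewrite -[r]compm1 -vh compmA rv comp1m.
Qed.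

Lemma aisleE :
  aisle T = [set A | forall B, coaisle T B -> forall f : hom A B, f = 0].
Proof.
case: T => X Y [sX sY h0 ht] sus /=; apply/seteqP; split=> A.
  by move=> XA B YB f; apply: h0.
move=> pA; have [S [D [u [v [w [XS YD t]]]]]] := ht A.
have [|h uh] := dist_lift t (g := idm A); first by rewrite (pA _ YD v) comp0l.
apply: (subcat_iso sX _ XS); exists u, h => //; apply/eqP; rewrite -subr_eq0.
apply/eqP/suspm_inj0; move/dist_rot: (t) => /dist_lift_third lif.
have [|m <-] := lif _ (suspm (h \oc u - idm S)).
  by rewrite compNl -suspmM compBr compmA uh comp1m compm1 subrr suspm0 oppr0.
by rewrite (h0 _ _ (sus _ XS) YD m) comp0r.
Qed.

Lemma aisle_ext_closed : ext_closed (aisle T).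
Proof.
rewrite aisleE => X Y Z u v w t pX pZ B YB f.
have [|h <-] := @dist_extend _ _ _ _ _ _ ((dist_rot _ _ _).1 t) B f.
  by rewrite compNr -suspmM (pX _ YB (f \oc u)) suspm0 oppr0.
by rewrite (pZ _ YB h) comp0l.
Qed.

Lemma aisle_precover S : exists X (c : hom X S), precover (aisle T) c.
Proof.
case: T => X Y [sX sY h0 ht] sus /=.
have [A [D [u [v [w [XA YD t]]]]]] := ht S; exists A, u; split => // S' g XS'.
by apply: (dist_lift t); apply: h0.
Qed.

End TStructure.
End TriangulatedCategories.

(** * Cyclic order on the circle and angles *)

Definition cyc3 (R : realDomainType) (a b c : R) : bool :=
  [|| (a < b) && (b < c), (b < c) && (c < a) | (c < a) && (a < b)].

Section Angles.
Variable R : realType.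
Implicit Types (x y z b p q : plane R) (t s : R).

(** Twice the signed area of the triangle. Since [ccw] only asserts that suitable angles exist, this
    sign is what shows that a triple and its reversal exclude each other. *)
Definition orient x y z : R :=
  (y.1 - x.1) * (z.2 - x.2) - (y.2 - x.2) * (z.1 - x.1).

Lemma orientC x y z : orient x z y = - orient x y z.
Proof. by rewrite /orient; ring. Qed.

(** The inscribed angles are [s], [t] and [pi - s - t]; twice the area of a triangle inscribed in
    the unit circle is four times the product of the sines of its angles. *)
Lemma orient_cis (a s t : R) :
  orient (cis a) (cis (a + s + s)) (cis (a + s + s + t + t)) =
  4 * (sin s * sin t * sin (s + t)).
Proof.
rewrite /orient /cis /= !(sinD, cosD).
have ha := cos2Dsin2 a; have hs := cos2Dsin2 s; have ht := cos2Dsin2 t.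
have {}ha : cos a ^+ 2 = 1 - sin a ^+ 2 by rewrite -ha; ring.
have {}hs : cos s ^+ 2 = 1 - sin s ^+ 2 by rewrite -hs; ring.
have {}ht : cos t ^+ 2 = 1 - sin t ^+ 2 by rewrite -ht; ring.
ring: ha hs ht.
Qed.

Lemma ccw_orient x y z : ccw x y z -> 0 < orient x y z.
Proof.
case=> [a [b [c [[ab bc ca] [-> -> ->]]]]].
have pi0 := @pi_gt0 R; move: ca; rewrite mulr2n => ca.
have -> : b = a + (b - a) / 2 + (b - a) / 2 by lra.
have -> : c = a + (b - a) / 2 + (b - a) / 2 + (c - b) / 2 + (c - b) / 2 by lra.
rewrite orient_cis; rewrite !mulr_gt0 ?sin_gt0_pi ?ltr0n //; try lra.
Qed.

Lemma cis_circle t : circle (cis t).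
Proof. by rewrite /circle /= cos2Dsin2. Qed.

Lemma cisD2pi t : cis (t + pi *+ 2) = cis t.
Proof. by rewrite /cis cosD2pi sinD2pi. Qed.

Lemma arg_ex x : circle x -> exists t, x = cis t /\ - pi < t <= pi.
Proof.
case: x => u v; rewrite /circle /= => h.
have pi0 := @pi_gt0 R.
have u1 : -1 <= u <= 1.
  rewrite -ler_norml -(@ler_pXn2r _ 2) ?nnegrE // expr1n real_normK ?num_real //.
  by rewrite -h lerDl sqr_ge0.
have s2 : Num.sqrt (1 - u ^+ 2) = `|v|.
  by rewrite -h addrC addKr sqrtr_sqr.
have [v0|v0] := leP 0 v.
  exists (acos u); rewrite /cis acosK ?in_itv //= sin_acos // s2 ger0_norm //.
  by split => //; have := acos_ge0 u1; have := acos_lepi u1; lra.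
exists (- acos u); rewrite /cis cosN sinN acosK ?in_itv //= sin_acos // s2.
rewrite ltr0_norm // opprK; split => //.
suff: acos u < pi by have := acos_ge0 u1; lra.
apply: acos_ltpi; case/andP: u1 => u1 ->; rewrite andbT lt_neqAle u1 andbT.
apply/eqP => uE; move: h v0; rewrite -uE.
rewrite sqrrN expr1n => /eqP; rewrite -subr_eq0 addrC addKr sqrf_eq0 => /eqP ->.
by rewrite ltxx.
Qed.

Definition arg x : R := xget 0 [set t | x = cis t /\ - pi < t <= pi].

Lemma argP x : circle x -> x = cis (arg x) /\ - pi < arg x <= pi.
Proof. by move=> /arg_ex h; apply: (xgetPex 0 h). Qed.

Lemma ccw_arg x y z : circle x -> circle y -> circle z ->
  ccw x y z <-> cyc3 (arg x) (arg y) (arg z).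
Proof.
move=> /argP[xE xb] /argP[yE yb] /argP[zE zb].
have pi0 := @pi_gt0 R.
have H (x' y' z' : plane R) : x' = cis (arg x') -> y' = cis (arg y') ->
    z' = cis (arg z') ->
    - pi < arg x' <= pi -> - pi < arg y' <= pi -> - pi < arg z' <= pi ->
    cyc3 (arg x') (arg y') (arg z') -> ccw x' y' z'.
  move=> {}xE {}yE {}zE {}xb {}yb {}zb /or3P[] h.
  - exists (arg x'), (arg y'), (arg z'); split => //; rewrite (mulr2n pi); split; lra.
  - exists (arg x'), (arg y' + pi *+ 2), (arg z' + pi *+ 2).
    by rewrite !cisD2pi; split => //; rewrite (mulr2n pi); split; lra.
  - exists (arg x'), (arg y'), (arg z' + pi *+ 2).
    by rewrite !cisD2pi; split => //; rewrite (mulr2n pi); split; lra.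
split; last exact: H.
move=> o; have := ccw_orient o.
have [|ncyc] := boolP (cyc3 _ _ _) => // o0.
have ne (u v : plane R) : u = cis (arg u) -> v = cis (arg v) ->
  arg u = arg v -> u = v by move=> {2}-> {2}-> ->.
have [e|n1] := eqVneq (arg x) (arg y).
  by move: o0; rewrite (ne _ _ xE yE e) /orient !subrr !mul0r subrr ltxx.
have [e|n2] := eqVneq (arg y) (arg z).
  by move: o0; rewrite (ne _ _ yE zE e) /orient mulrC subrr ltxx.
have [e|n3] := eqVneq (arg z) (arg x).
  by move: o0; rewrite (ne _ _ zE xE e) /orient !subrr !mulr0 subrr ltxx.
have /ccw_orient : ccw x z y.
  by apply: H => //; move: ncyc n1 n2 n3; rewrite /cyc3; lra.
by rewrite orientC; lra.
Qed.

(** Anti-clockwise angle from [b], in [[0, 2 pi)]: the circle is cut open at [b]. *)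
Definition ang b z : R :=
  if arg z < arg b then arg z - arg b + pi *+ 2 else arg z - arg b.

Lemma ang_spec b z :
  (arg b <= arg z /\ ang b z = arg z - arg b) \/
  (arg z < arg b /\ ang b z = arg z - arg b + (pi + pi)).
Proof. by rewrite /ang; case: ltP => h; [right|left]. Qed.

Lemma angP b z : circle b -> circle z -> z = cis (arg b + ang b z).
Proof.
move=> /argP[_ _] /argP[zE _]; rewrite /ang; case: ifP => _.
  by rewrite addrA cisD2pi addrC subrK.
by rewrite addrC subrK.
Qed.

Lemma ang_bounds b z : circle b -> circle z -> 0 <= ang b z < pi *+ 2.
Proof.
move=> /argP[_ bb] /argP[_ zb]; rewrite mulr2n.
by case: (ang_spec b z) => -[h ->]; lra.
Qed.

Lemma angbb b : ang b b = 0.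
Proof. by rewrite /ang ltxx subrr. Qed.

Lemma ccw_ang b x y z : circle b -> circle x -> circle y -> circle z ->
  ccw x y z <-> cyc3 (ang b x) (ang b y) (ang b z).
Proof.
move=> cb cx cy cz; rewrite (ccw_arg cx cy cz).
have [_ bb] := argP cb; have [_ xb] := argP cx; have [_ yb] := argP cy.
have [_ zb] := argP cz; have pi0 := @pi_gt0 R; rewrite /cyc3.
case: (ang_spec b x) => -[hx ->]; case: (ang_spec b y) => -[hy ->];
  case: (ang_spec b z) => -[hz ->]; split; lra.
Qed.

Lemma ang_inj b x y : circle b -> circle x -> circle y ->
  ang b x = ang b y -> x = y.
Proof. by move=> cb cx cy e; rewrite (angP cb cx) e -angP. Qed.

Lemma ang_cis b t : circle b -> 0 <= t < pi *+ 2 -> ang b (cis (arg b + t)) = t.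
Proof.
move=> cb tb; set q := cis _; have cq : circle q by exact: cis_circle.
have [_ bb] := argP cb; have pi0 := @pi_gt0 R.
have := ang_bounds cb cq; have := angP cb cq; set s := ang b q => e sb.
move: tb sb; rewrite mulr2n => tb sb.
(* A point with two such angles would be both outer points of a [ccw] triple, whose orientation is
   zero. *)
have key (u v : R) : 0 <= u < v -> v < pi + pi -> cis (arg b + u) <> cis (arg b + v).
  move=> uv v2 uvE.
  have : ccw (cis (arg b + u)) (cis ((arg b + u) + (v - u) / 2)) (cis (arg b + v)).
    by exists (arg b + u), ((arg b + u) + (v - u) / 2), (arg b + v);
      split => //; rewrite (mulr2n pi); split; lra.
  by move/ccw_orient; rewrite uvE /orient !subrr !mulr0 subrr ltxx.
have [lt|lt|//] := ltgtP s t.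
  by case: (key s t); [lra|lra|].
by case: (key t s); [lra|lra|].
Qed.

Lemma cis_near t (U : set (plane R)) : nbhs (cis t) U ->
  exists2 e, 0 < e & forall s, `|t - s| < e -> U (cis s).
Proof.
move=> nU; have : {for t, continuous (@cis R)}.
  apply: (@cvg_pair _ _ _ _ (nbhs (cos t)) (nbhs (sin t))).
  - exact: continuous_cos.
  - exact: continuous_sin.
by move=> /(_ _ nU) /nbhs_ballP[e e0 he]; exists e.
Qed.

Definition adh_left (A : set (plane R)) q :=
  forall p, circle p -> p <> q -> exists2 z, A z & ccw p z q.

Definition adh_right (A : set (plane R)) q :=
  forall p, circle p -> p <> q -> exists2 z, A z & ccw q z p.

Lemma adh_left_nbhs (A U : set (plane R)) q : A `<=` @circle R -> circle q ->
  adh_left A q -> nbhs q U -> exists z, [/\ A z, U z & z <> q].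
Proof.
move=> Ac cq aA nU; have pi0 := @pi_gt0 R.
have [qE _] := argP cq; rewrite qE in nU.
have [e e0 he] := cis_near nU.
(* The minimum with [pi] keeps [p] different from [q] when [e] is large. *)
pose d := Num.min e pi.
have [d0 de dp] : [/\ 0 < d, d <= e & d <= pi].
  by rewrite /d lt_min e0 pi0 !ge_min !lexx orbT.
pose p := cis (arg q - d); have cp : circle p by exact: cis_circle.
have qp : ang q p = pi + pi - d.
  have pE : p = cis (arg q + (pi + pi - d)).
    by rewrite -[p]cisD2pi mulr2n; congr cis; lra.
  by rewrite pE ang_cis // (mulr2n pi); lra.
have [|z Az] := aA p cp; first by move=> pq; move: qp; rewrite pq angbb; lra.
have cz := Ac z Az; move=> /(ccw_ang cq cp cz cq); rewrite angbb qp => zq.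
have := ang_bounds cq cz; rewrite (mulr2n pi) => zb.
exists z; split => //; last by move=> zE; move: zq; rewrite zE angbb /cyc3; lra.
have -> : z = cis (arg q + (ang q z - (pi + pi))).
  rewrite -[RHS]cisD2pi {1}(angP cq cz) (mulr2n pi); congr cis; lra.
apply: he; rewrite opprD addrA subrr sub0r normrN ltr_norml.
by move: zq; rewrite /cyc3; lra.
Qed.

Lemma adh_right_nbhs (A U : set (plane R)) q : A `<=` @circle R -> circle q ->
  adh_right A q -> nbhs q U -> exists z, [/\ A z, U z & z <> q].
Proof.
move=> Ac cq aA nU; have pi0 := @pi_gt0 R.
have [qE _] := argP cq; rewrite qE in nU.
have [e e0 he] := cis_near nU.
pose d := Num.min e pi.
have [d0 de dp] : [/\ 0 < d, d <= e & d <= pi].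
  by rewrite /d lt_min e0 pi0 !ge_min !lexx orbT.
pose p := cis (arg q + d); have cp : circle p by exact: cis_circle.
have qp : ang q p = d by rewrite ang_cis // (mulr2n pi); lra.
have [|z Az] := aA p cp; first by move=> pq; move: qp; rewrite pq angbb; lra.
have cz := Ac z Az; move=> /(ccw_ang cq cq cz cp); rewrite angbb qp => zq.
have := ang_bounds cq cz; rewrite (mulr2n pi) => zb.
exists z; split => //; last by move=> zE; move: zq; rewrite zE angbb /cyc3; lra.
rewrite {1}(angP cq cz).
apply: he; rewrite opprD addrA subrr sub0r normrN ltr_norml.
by move: zq; rewrite /cyc3; lra.
Qed.

(* At [q = b] the supremum of the angles is [2 pi]: no upper bound holds. *)
Lemma sup_ang (A : set (plane R)) b : A `<=` @circle R -> circle b -> A !=set0 ->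
  (exists2 q, A q & forall z, A z -> ang b z <= ang b q) \/
  exists q, [/\ circle q, adh_left A q &
    q = b \/ forall z, A z -> ang b z < ang b q].
Proof.
move=> Ac cb [z0 Az0]; have pi0 := @pi_gt0 R.
pose B := [set ang b z | z in A].
have hB : has_sup B.
  split; first by exists (ang b z0), z0.
  exists (pi + pi) => _ [z Az <-].
  by have := ang_bounds cb (Ac z Az); rewrite (mulr2n pi); lra.
have ubB z : A z -> ang b z <= sup B.
  by move=> Az; apply: sup_upper_bound => //; exists z.
have [[q Aq qs]|nq] := pselect (exists2 q, A q & ang b q = sup B).
  by left; exists q => // z; rewrite qs; exact: ubB.
have lts z : A z -> ang b z < sup B.
  move=> Az; rewrite lt_neqAle ubB // andbT; apply/eqP => e.
  by apply: nq; exists z.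
have adh r : r < sup B -> exists2 z, A z & r < ang b z.
  move=> rs; have [|_ [z Az <-]] := @sup_adherent _ B (sup B - r) _ hB.
    by rewrite subr_gt0.
  by rewrite subKr => h; exists z.
have s0 : 0 <= sup B.
  by have := ubB _ Az0; have := ang_bounds cb (Ac _ Az0); lra.
have s2 : sup B <= pi + pi.
  apply: ge_sup => [|_ [z Az <-]]; first by exists (ang b z0), z0.
  by have := ang_bounds cb (Ac z Az); rewrite (mulr2n pi); lra.
right; have [sE|sl] : sup B = pi + pi \/ sup B < pi + pi.
  by case: ltgtP s2 => //; [right|left].
  exists b; split => //; last by left.
  move=> p cp pb; have pb0 := ang_bounds cb cp; rewrite (mulr2n pi) in pb0.
  have p0 : ang b p != 0.
    by apply/eqP; rewrite -(angbb b) => /(ang_inj cb cp cb).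
  have [|z Az zp] := adh (ang b p); first by rewrite sE; lra.
  exists z => //; apply/(ccw_ang cb cp (Ac z Az) cb); rewrite angbb /cyc3.
  by lra.
pose q := cis (arg b + sup B); have cq : circle q by exact: cis_circle.
have qs : ang b q = sup B by rewrite ang_cis // (mulr2n pi) s0.
exists q; split => //; last by right => z; rewrite qs; exact: lts.
move=> p cp pq; have pqn : ang b p != sup B.
  by apply/eqP; rewrite -qs => /(ang_inj cb cp cq).
have [ps|sp|e] := ltgtP (ang b p) (sup B); last by rewrite e eqxx in pqn.
  have [z Az zp] := adh _ ps; exists z => //.
  apply/(ccw_ang cb cp (Ac z Az) cq); rewrite qs /cyc3.
  by have := lts z Az; lra.
exists z0 => //; apply/(ccw_ang cb cp (Ac z0 Az0) cq); rewrite qs /cyc3.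
by have := lts z0 Az0; lra.
Qed.

(** Unlike a supremum, the infimum stays below [2 pi], so it is always the angle of a point and
    there is no exceptional case at [b]. *)
Lemma inf_ang (A : set (plane R)) b : A `<=` @circle R -> circle b -> A !=set0 ->
  (exists2 q, A q & forall z, A z -> ang b q <= ang b z) \/
  exists q, [/\ circle q, adh_right A q & forall z, A z -> ang b q < ang b z].
Proof.
move=> Ac cb [z0 Az0]; have pi0 := @pi_gt0 R.
pose B := [set ang b z | z in A].
have hB : has_inf B.
  split; first by exists (ang b z0), z0.
  exists 0 => _ [z Az <-].
  by have := ang_bounds cb (Ac z Az); lra.
have lbB z : A z -> inf B <= ang b z.
  by move=> Az; apply: inf_lbound; [case: hB|exists z].
have [[q Aq qs]|nq] := pselect (exists2 q, A q & ang b q = inf B).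
  by left; exists q => // z; rewrite qs; exact: lbB.
have gti z : A z -> inf B < ang b z.
  move=> Az; rewrite lt_neqAle lbB // andbT; apply/eqP => e.
  by apply: nq; exists z.
have adh r : inf B < r -> exists2 z, A z & ang b z < r.
  move=> rs; have [|_ [z Az <-]] := @inf_adherent _ B (r - inf B) _ hB.
    by rewrite subr_gt0.
  by rewrite addrC subrK => h; exists z.
have i0 : 0 <= inf B.
  apply: lb_le_inf => [|_ [z Az <-]]; first by exists (ang b z0), z0.
  by have := ang_bounds cb (Ac z Az); lra.
have i2 : inf B < pi + pi.
  have := lbB _ Az0; have := ang_bounds cb (Ac z0 Az0).
  by rewrite (mulr2n pi); lra.
pose q := cis (arg b + inf B); have cq : circle q by exact: cis_circle.
have qs : ang b q = inf B by rewrite ang_cis // (mulr2n pi) i0.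
right; exists q; split => //; last by move=> z; rewrite qs; exact: gti.
move=> p cp pq; have pqn : ang b p != inf B.
  by apply/eqP; rewrite -qs => /(ang_inj cb cp cq).
have [pi|ip|e] := ltgtP (ang b p) (inf B); last by rewrite e eqxx in pqn.
  exists z0 => //; apply/(ccw_ang cb cq (Ac z0 Az0) cp); rewrite qs /cyc3.
  by have := gti z0 Az0; lra.
have [z Az zp] := adh _ ip; exists z => //.
apply/(ccw_ang cb cq (Ac z Az) cp); rewrite qs /cyc3.
by have := gti z Az; lra.
Qed.

(** Starting at the antipode of [q], [p] is moved to each point of the list that lies between [p]
    and [q]. *)
Lemma finite_left_gap (F : set (plane R)) q : F `<=` @circle R -> finite_set F ->
  circle q -> exists p, [/\ circle p, p <> q & forall l, F l -> ~ ccw p l q].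
Proof.
move=> Fc /finite_seqP[s Fs] cq; have pi0 := @pi_gt0 R.
have {Fc} : forall l, l \in s -> circle l by move=> l ls; apply: Fc; rewrite Fs.
suff H : (forall l, l \in s -> circle l) ->
    exists p, [/\ circle p, p <> q & forall l, l \in s -> ~ ccw p l q].
  by move=> /H [p [cp pq h]]; exists p; split => // l; rewrite Fs => /h.
elim: s {Fs} => [_|x s IH sc].
  have cp : circle (cis (arg q + pi)) by exact: cis_circle.
  have e : ang q (cis (arg q + pi)) = pi.
    by rewrite ang_cis // (mulr2n pi); lra.
  exists (cis (arg q + pi)); split => // pq.
  by move: e; rewrite pq angbb; lra.
have [|p [cp pq h]] := IH; first by move=> l ls; apply: sc; rewrite inE ls orbT.
have cx : circle x by apply: sc; rewrite mem_head.
have [pxq|npxq] := pselect (ccw p x q); last first.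
  by exists p; split => // l; rewrite inE => /predU1P[->|/h].
move/(ccw_ang cq cp cx cq): (pxq); rewrite angbb => pxq'.
exists x; split => //; first by move=> xq; move: pxq'; rewrite xq angbb /cyc3; lra.
move=> l; rewrite inE => /predU1P[->|ls].
  by move=> /(ccw_ang cq cx cx cq); rewrite /cyc3; lra.
have cl : circle l by apply: sc; rewrite inE ls orbT.
move=> /(ccw_ang cq cx cl cq) xlq; apply: (h l ls).
apply/(ccw_ang cq cp cl cq); move: xlq pxq'; rewrite angbb /cyc3.
by have := ang_bounds cq cp; lra.
Qed.

End Angles.

(** * Segments of an admissible set *)

Section Admissible.
Variables (R : realType) (Z : set (plane R)).
Hypothesis hZ : admissible Z.
Implicit Types (x y z b p q l : plane R).
Local Notation L := (limit_points Z).
Local Notation sc := (zsucc Z).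
Local Notation pd := (zpred Z).

Lemma Z_circle z : Z z -> circle z.
Proof. by case: hZ => h _ _ _ _; exact: h. Qed.

Lemma finite_next (F : set (plane R)) z : F `<=` @circle R -> finite_set F ->
  F !=set0 -> exists2 l, F l & forall l', F l' -> ang z l <= ang z l'.
Proof.
move=> Fc /finite_seqP[s ->] [l0]; move: l0.
elim: s {Fc} => [//|x s IH] l0 _.
have [[l1 l1s]|ns] := pselect ([set` s] !=set0); last first.
  exists x; first by rewrite /= mem_head.
  move=> l' /=; rewrite inE => /predU1P[->//|l's]; case: ns; by exists l'.
have [l /= ls lm] := IH l1 l1s.
have [xl|lx] := leP (ang z x) (ang z l).
  exists x => /=; first by rewrite mem_head.
  by move=> l'; rewrite inE => /predU1P[->//|/lm]; exact: le_trans.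
exists l => /=; first by rewrite inE ls orbT.
by move=> l'; rewrite inE => /predU1P[->|/lm//]; exact: ltW.
Qed.

Lemma L_circle l : L l -> circle l.
Proof.
case=> cl _; have cc : closed (@circle R).
  have : closed ((fun p : R * R => p.1 ^+ 2 + p.2 ^+ 2) @^-1` [set x | x = 1]).
    apply: preimage_closed; last exact: closed_eq.
    move=> p _; apply: (@cvgD _ _ _ (nbhs p) _
      (fun p : R * R => p.1 ^+ 2) (fun p => p.2 ^+ 2));
      apply: (@continuous_comp _ _ _ _ (fun u : R => u ^+ 2)).
    - exact: cvg_fst.
    - exact: exprn_continuous.
    - exact: cvg_snd.
    - exact: exprn_continuous.
  by [].
by apply: cc; apply: closure_subset cl => z; exact: Z_circle.
Qed.

Lemma L_notZ l : L l -> ~ Z l. Proof. by case. Qed.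

Lemma L_neqZ l z : L l -> Z z -> z <> l.
Proof. by move=> /L_notZ nZ Zz e; apply: nZ; rewrite -e. Qed.

Lemma limit_of_approach (A : set (plane R)) q : A `<=` Z -> circle q ->
  (forall U, nbhs q U -> exists z, [/\ A z, U z & z <> q]) -> L q.
Proof.
move=> AZ cq h; split.
  by move=> U /h [z [/AZ Zz Uz _]]; exists z.
move=> Zq; case: hZ => _ iso _ _ _; have [_ [V nV VE]] := iso q Zq.
have [z [/AZ Zz Vz zq]] := h V nV.
by have : [set q] z by rewrite -VE; split.
Qed.

Lemma adh_left_L (A : set (plane R)) q : A `<=` Z -> circle q ->
  adh_left A q -> L q.
Proof.
move=> AZ cq aA; apply: (limit_of_approach AZ cq) => U.
by apply: adh_left_nbhs => // z /AZ /Z_circle.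
Qed.

Lemma adh_right_L (A : set (plane R)) q : A `<=` Z -> circle q ->
  adh_right A q -> L q.
Proof.
move=> AZ cq aA; apply: (limit_of_approach AZ cq) => U.
by apply: adh_right_nbhs => // z /AZ /Z_circle.
Qed.

Lemma limit_right l p : L l -> circle p -> p <> l ->
  exists2 z, Z z & ccw l z p.
Proof. by case: hZ => _ _ _ _ h Ll cp pl; case: (h l Ll p cp pl). Qed.

Lemma limit_left l p : L l -> circle p -> p <> l ->
  exists2 z, Z z & ccw p z l.
Proof. by case: hZ => _ _ _ _ h Ll cp pl; case: (h l Ll p cp pl). Qed.

Lemma finite_L : finite_set L. Proof. by case: hZ => _ _ _ []. Qed.

Lemma L_nonempty : L !=set0. Proof. by case: hZ => _ _ _ []. Qed.

Lemma ang_gt0 b x : circle b -> circle x -> x <> b -> 0 < ang b x.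
Proof.
move=> cb cx xb; rewrite lt_neqAle; have := ang_bounds cb cx => /andP[-> _].
rewrite andbT; apply/eqP => e; apply/xb/(ang_inj cb cx cb).
by rewrite -e angbb.
Qed.

Lemma Z_other z : Z z -> exists2 w, Z w & w <> z.
Proof.
move=> Zz; apply: contrapT => h; case: hZ => _ _ iZ _ _; apply: iZ.
apply: (@sub_finite_set _ _ [set z]); last exact: finite_set1.
by move=> w Zw /=; apply: contrapT => wz; apply: h; exists w.
Qed.

(** An infimum of angles that is not attained would be a limit point; being two-sided, it would also
    be approached from the side of [z], by points of [Z] below the infimum. *)
Lemma succP z : Z z -> is_succ Z z (sc z).
Proof.
move=> Zz; apply: (xgetPex z); have cz := Z_circle Zz.
have [w0 Zw0 w0z] := Z_other Zz.
have [|||[q [Zq qz] mq]|[q [cq aq mq]]] :=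
    @inf_ang _ [set w | Z w /\ w <> z] z.
- by move=> w [/Z_circle].
- by [].
- by exists w0.
- exists q; split => // u Zu; have cu := Z_circle Zu.
  have cq := Z_circle Zq.
  move=> /(ccw_ang cz cz cu cq); rewrite angbb.
  have [->|/eqP uz] := eqVneq u z; first by rewrite angbb /cyc3; lra.
  by have := ang_gt0 cz cq qz; have := mq _ (conj Zu uz); rewrite /cyc3; lra.
have Lq : L q by apply: adh_right_L aq => // w [].
have zq : z <> q by apply: L_neqZ.
have [w Zw /(ccw_ang cz cz (Z_circle Zw) cq)] := limit_left Lq cz zq.
rewrite angbb; have := ang_bounds cz cq.
have [->|/eqP wz] := eqVneq w z; first by rewrite angbb /cyc3; lra.
by have := mq _ (conj Zw wz); rewrite /cyc3; lra.
Qed.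

Lemma predP z : Z z -> is_pred Z z (pd z).
Proof.
move=> Zz; apply: (xgetPex z); have cz := Z_circle Zz.
have [w0 Zw0 w0z] := Z_other Zz.
have [|||[q [Zq qz] mq]|[q [cq aq mq]]] :=
    @sup_ang _ [set w | Z w /\ w <> z] z.
- by move=> w [/Z_circle].
- by [].
- by exists w0.
- exists q; split => // u Zu; have cu := Z_circle Zu.
  have cq := Z_circle Zq.
  move=> /(ccw_ang cz cq cu cz); rewrite angbb.
  have [->|/eqP uz] := eqVneq u z; first by rewrite angbb /cyc3; lra.
  by have := ang_gt0 cz cu uz; have := mq _ (conj Zu uz); rewrite /cyc3; lra.
have Lq : L q by apply: adh_left_L aq => // w [].
have zq : z <> q by apply: L_neqZ.
case: mq => [qz|mq]; first by case: zq.
have [w Zw /(ccw_ang cz cq (Z_circle Zw) cz)] := limit_right Lq cz zq.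
rewrite angbb; have := ang_gt0 cz cq (nesym zq).
have [->|/eqP wz] := eqVneq w z; first by rewrite angbb /cyc3; lra.
have := ang_gt0 cz (Z_circle Zw) wz.
by have := mq _ (conj Zw wz); rewrite /cyc3; lra.
Qed.

Lemma Z_succ z : Z z -> Z (sc z). Proof. by case/succP. Qed.
Lemma Z_pred z : Z z -> Z (pd z). Proof. by case/predP. Qed.

Section Base.
Variable l : plane R.
Hypothesis Ll : L l.
Let cl : circle l := L_circle Ll.

Lemma ccw_angL x y z : Z x -> Z y -> Z z ->
  ccw x y z <-> cyc3 (ang l x) (ang l y) (ang l z).
Proof. by move=> /Z_circle cx /Z_circle cy /Z_circle cz; exact: ccw_ang. Qed.

Lemma angL_gt0 z : Z z -> 0 < ang l z.
Proof. by move=> Zz; apply: ang_gt0 => //; [exact: Z_circle|exact: L_neqZ]. Qed.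

Lemma angL_inj x y : Z x -> Z y -> ang l x = ang l y -> x = y.
Proof. by move=> /Z_circle cx /Z_circle cy; exact: ang_inj. Qed.

Lemma angL_neq x y : Z x -> Z y -> x <> y -> ang l x != ang l y.
Proof. by move=> Zx Zy xy; apply/eqP => /(angL_inj Zx Zy). Qed.

(** No successor jumps over the base point, because [Z] has points between [z] and the limit point
    [l]. *)
Lemma succ_gt z : Z z -> ang l z < ang l (sc z).
Proof.
move=> Zz; have [Zs sz h] := succP Zz.
have := angL_neq Zs Zz sz; rewrite neq_lt => /orP[lt|//].
have [u Zu /(ccw_ang cl (Z_circle Zz) (Z_circle Zu) cl) uz] :=
  limit_left Ll (Z_circle Zz) (L_neqZ Ll Zz).
case: (h u Zu); apply/(ccw_angL Zz Zu Zs); move: uz.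
by rewrite angbb /cyc3; have := angL_gt0 Zu; lra.
Qed.

Lemma succ_le z u : Z z -> Z u -> ang l z < ang l u -> ang l (sc z) <= ang l u.
Proof.
move=> Zz Zu zu; have [Zs sz h] := succP Zz.
rewrite leNgt; apply/negP => us; apply: (h u Zu).
by apply/(ccw_angL Zz Zu Zs); rewrite /cyc3 zu us.
Qed.

Lemma pred_lt z : Z z -> ang l (pd z) < ang l z.
Proof.
move=> Zz; have [Zs sz h] := predP Zz.
have := angL_neq Zs Zz sz; rewrite neq_lt => /orP[//|lt].
have [u Zu /(ccw_ang cl cl (Z_circle Zu) (Z_circle Zz)) uz] :=
  limit_right Ll (Z_circle Zz) (L_neqZ Ll Zz).
case: (h u Zu); apply/(ccw_angL Zs Zu Zz); move: uz.
by rewrite angbb /cyc3; have := angL_gt0 Zu; have := angL_gt0 Zz; lra.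
Qed.

Lemma pred_ge z u : Z z -> Z u -> ang l u < ang l z -> ang l u <= ang l (pd z).
Proof.
move=> Zz Zu zu; have [Zs sz h] := predP Zz.
rewrite leNgt; apply/negP => us; apply: (h u Zu).
by apply/(ccw_angL Zs Zu Zz); rewrite /cyc3 zu us.
Qed.

Lemma le_of_lt_succ z u : Z z -> Z u -> ang l u < ang l (sc z) -> ang l u <= ang l z.
Proof.
by move=> Zz Zu us; rewrite leNgt; apply/negP => /(succ_le Zz Zu); lra.
Qed.

Lemma no_limit_between z q : Z z -> L q ->
  ~ (ang l (pd z) < ang l q /\ ang l q < ang l z).
Proof.
move=> Zz Lq [h1 h2]; have Zp := Z_pred Zz; have [_ _ h] := predP Zz.
have cq := L_circle Lq; have cz := Z_circle Zz.
have [u Zu /(ccw_ang cl cq (Z_circle Zu) cz) uz] :=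
  limit_right Lq cz (L_neqZ Lq Zz).
by apply: (h u Zu); apply/(ccw_angL Zp Zu Zz); move: uz; rewrite /cyc3; lra.
Qed.

End Base.

Lemma succK z : Z z -> pd (sc z) = z.
Proof.
move=> Zz; have [l Ll] := L_nonempty; have Zs := Z_succ Zz.
have Zp := Z_pred Zs; apply/(angL_inj Ll Zp Zz)/eqP; rewrite eq_le.
rewrite (pred_ge Ll Zs Zz (succ_gt Ll Zz)) andbT.
exact: le_of_lt_succ (pred_lt Ll Zs).
Qed.

Lemma predK z : Z z -> sc (pd z) = z.
Proof.
move=> Zz; have [l Ll] := L_nonempty; have Zp := Z_pred Zz.
have Zs := Z_succ Zp; apply/(angL_inj Ll Zs Zz)/eqP; rewrite eq_le.
rewrite (succ_le Ll Zp Zz (pred_lt Ll Zz)) /= leNgt; apply/negP.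
by move=> /(pred_ge Ll Zz Zs); have := succ_gt Ll Zp; lra.
Qed.

(* [z] lies in the segment of [Z] that ends at the limit point [l]. *)
Definition seg l z := [/\ Z z, L l & forall q, L q -> ang l q <= ang l z].

(* [z] lies in the segment of [Z] that starts at the limit point [l]. *)
Definition lseg l z := [/\ Z z, L l & forall q, L q -> ~ ccw l q z].

Lemma seg_up l s z : seg l s -> Z z -> ang l s <= ang l z -> seg l z.
Proof. by case=> Zs Ll h Zz sz; split => // q /h; lra. Qed.

Lemma seg_pred l z : seg l z -> seg l (pd z).
Proof.
case=> Zz Ll h; split; [exact: Z_pred|by []|move=> q Lq].
rewrite leNgt; apply/negP => lt; apply: (no_limit_between Ll Zz Lq); split=> //.
rewrite lt_neqAle h // andbT; apply/eqP => /(ang_inj (L_circle Ll)) e.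
by apply: (L_neqZ Lq Zz); rewrite e //; [exact: L_circle|exact: Z_circle].
Qed.

Lemma seg_succ l z : seg l z -> seg l (sc z).
Proof.
move=> hs; have [Zz Ll _] := hs; apply: seg_up hs (Z_succ Zz) _.
exact/ltW/succ_gt.
Qed.

Lemma seg_nccw l z q : seg l z -> L q -> ~ ccw z q l.
Proof.
case=> Zz Ll h Lq; have cl := L_circle Ll.
move=> /(ccw_ang cl (Z_circle Zz) (L_circle Lq) cl); rewrite angbb /cyc3.
by have := h q Lq; have := angL_gt0 Ll Zz; have := ang_bounds cl (L_circle Lq); lra.
Qed.

Lemma nccw_seg l z : Z z -> L l -> (forall q, L q -> ~ ccw z q l) -> seg l z.
Proof.
move=> Zz Ll h; split => // q Lq; have cl := L_circle Ll.
rewrite leNgt; apply/negP => lt; apply: (h q Lq).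
apply/(ccw_ang cl (Z_circle Zz) (L_circle Lq) cl); rewrite angbb /cyc3.
by have := angL_gt0 Ll Zz; lra.
Qed.

Lemma seg_inj l l' z : seg l z -> seg l' z -> l = l'.
Proof.
move=> sl sl'; have [Zz Ll _] := sl; have [_ Ll' _] := sl'.
have cz := Z_circle Zz; have cl := L_circle Ll; have cl' := L_circle Ll'.
have h := seg_nccw sl Ll'; have h' := seg_nccw sl' Ll.
have p : 0 < ang z l by apply: ang_gt0 => //; apply/nesym/L_neqZ.
have p' : 0 < ang z l' by apply: ang_gt0 => //; apply/nesym/L_neqZ.
apply: (ang_inj cz cl cl'); apply/eqP; rewrite eq_le !leNgt.
apply/andP; split; apply/negP => lt.
  by apply: h; apply/(ccw_ang cz cz cl' cl); rewrite angbb /cyc3; lra.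
by apply: h'; apply/(ccw_ang cz cz cl cl'); rewrite angbb /cyc3; lra.
Qed.

Lemma seg_ex z : Z z -> exists l, seg l z.
Proof.
move=> Zz; have [l Ll lm] := finite_next z L_circle finite_L L_nonempty.
exists l; apply: nccw_seg => // q Lq; have cz := Z_circle Zz.
move=> /(ccw_ang cz cz (L_circle Lq) (L_circle Ll)); rewrite angbb /cyc3.
by have := lm q Lq; have := ang_bounds cz (L_circle Lq);
   have := ang_bounds cz (L_circle Ll); lra.
Qed.

Lemma left_gap_seg q p z : L q -> circle p -> (forall l, L l -> ~ ccw p l q) ->
  Z z -> ccw p z q -> seg q z.
Proof.
move=> Lq cp h Zz pzq; apply: nccw_seg => // l Ll zlq; apply: (h l Ll).
have cq := L_circle Lq; have cz := Z_circle Zz; have cl := L_circle Ll.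
move/(ccw_ang cq cp cz cq): pzq; move/(ccw_ang cq cz cl cq): zlq => h1 h2.
apply/(ccw_ang cq cp cl cq); move: h1 h2; rewrite angbb /cyc3.
have := ang_bounds cq cz; have := ang_bounds cq cl; have := ang_bounds cq cp.
by lra.
Qed.

(* Downward induction inside a segment of [Z], although [Z] itself is not
   well ordered: bounded nonempty subsets of a segment have a maximum. *)
Lemma seg_ind l s' s (P : plane R -> Prop) : seg l s' -> Z s ->
  ang l s' <= ang l s ->
  (forall m, seg l m -> ang l m <= ang l s ->
    (forall m', Z m' -> ang l m < ang l m' -> ang l m' <= ang l s -> P m') ->
    P m) -> P s'.
Proof.
move=> hs' Zs ss' IH; have [Zs' Ll hl] := hs'; have cl := L_circle Ll.
apply: contrapT => nP.
pose A := [set m | [/\ Z m, ang l s' <= ang l m <= ang l s & ~ P m]].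
have [|||[m [Zm mb nPm] mm]|[q [cq aq bq]]] := @sup_ang _ A l.
- by move=> m [/Z_circle].
- by [].
- by exists s'; split => //; rewrite lexx.
- apply: nPm; apply: (IH m); [by apply: seg_up hs' _ _ => //; lra|by lra|].
  move=> m' Zm' mm' m's; apply: contrapT => nPm'.
  have Am' : A m' by split => //; lra.
  by have := mm _ Am'; lra.
have Lq : L q by apply: adh_left_L aq => // m [].
have cs := Z_circle Zs.
have [m [Zm mb nPm]] := aq _ cs (L_neqZ Lq Zs).
move=> /(ccw_ang cl cs (Z_circle Zm) cq); rewrite /cyc3.
case: bq => [->|bq]; first by rewrite angbb; have := angL_gt0 Ll Zm; lra.
have Am : A m by [].
have := bq _ Am; have := hl q Lq.
by lra.
Qed.

End Admissible.

(** * Arcs closed under crossing and suspension *)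

Section Arcs.
Variables (R : realType) (Z : set (plane R)).
Hypothesis hZ : admissible Z.
Implicit Types (x y z b p q l s u w : plane R).
Local Notation L := (limit_points Z).
Local Notation sc := (zsucc Z).
Local Notation pd := (zpred Z).

Definition arc s w := [/\ Z s, Z w & [/\ w <> pd s, w <> s & w <> sc s]].

Lemma arc_sym s w : arc s w -> arc w s.
Proof.
case=> Zs Zw [h1 h2 h3]; split => //; split.
- by move=> e; apply: h3; rewrite e predK.
- by move=> e; apply: h2.
- by move=> e; apply: h1; rewrite e succK.
Qed.

Lemma is_arcE s w : Z s -> Z w -> is_arc Z [set s; w] <-> arc s w.
Proof.
move=> Zs Zw; split => [[z0 [z1 [Z0 Z1 e [h1 h2 h3]]]]|[_ _ h]]; last first.
  by exists s, w.
have a01 : arc z0 z1 by [].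
have : [set z0; z1] s by rewrite -e; left.
have : [set s; w] z1 by rewrite e; right.
have : [set s; w] z0 by rewrite e; left.
move=> [z0E|z0E] [z1E|z1E] _; first by case: h2; rewrite z0E.
- by rewrite -z0E -z1E.
- by apply: arc_sym; rewrite -z0E -z1E.
- by case: h2; rewrite z0E.
Qed.

Lemma arc_pred s w : arc s w -> arc (pd s) (pd w).
Proof.
case=> Zs Zw [h1 h2 h3]; split; [exact: Z_pred|exact: Z_pred|].
have inj x y : Z x -> Z y -> pd x = pd y -> x = y.
  by move=> Zx Zy /(congr1 sc); rewrite !predK.
split=> [/inj e|/inj e|].
- by apply: h1; apply: e => //; apply: Z_pred.
- by apply: h2; apply: e.
- by rewrite predK // => e; apply: h3; rewrite -e predK.
Qed.

Lemma arc_succ s w : arc s w -> arc (sc s) (sc w).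
Proof.
case=> Zs Zw [h1 h2 h3]; split; [exact: Z_succ|exact: Z_succ|].
have inj x y : Z x -> Z y -> sc x = sc y -> x = y.
  by move=> Zx Zy /(congr1 pd); rewrite !succK.
split=> [|/inj e|/inj e].
- by rewrite succK // => e; apply: h1; rewrite -e succK.
- by apply: h2; apply: e.
- by apply: h3; apply: e => //; apply: Z_succ.
Qed.

Lemma arc_near l s w : Z s -> Z w -> L l -> ang l (sc s) < ang l w -> arc s w.
Proof.
move=> Zs Zw Ll h; have h1 := succ_gt hZ Ll Zs; have h2 := pred_lt hZ Ll Zs.
by split => //; split=> e; move: h; rewrite e; lra.
Qed.

Lemma seg_arc l l' s w : seg Z l s -> seg Z l' w -> l <> l' -> arc s w.
Proof.
move=> hs hw ll'; have [Zs _ _] := hs; have [Zw _ _] := hw.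
split => //; split=> e; apply: ll'; apply: (seg_inj hZ) hw; rewrite e //.
  exact: seg_pred.
exact: seg_succ.
Qed.

Lemma ccw4_lin b x y z t : circle b -> circle x -> circle y -> circle z ->
  circle t -> ang b x < ang b y -> ang b y < ang b z -> ang b z < ang b t ->
  ccw4 x y z t.
Proof.
move=> cb cx cy cz ct h1 h2 h3.
by split; apply/(ccw_ang cb) => //; rewrite /cyc3; lra.
Qed.

Lemma ccw4_rot x y z t : ccw4 x y z t -> ccw4 y z t x.
Proof. by case. Qed.

(* The arc relation of a subcategory closed under extensions and suspension;
   it is declared to hold for the pairs that are not arcs. *)
Record ptolemy (v : plane R -> plane R -> Prop) : Prop := Ptolemy {
  pt_sym : forall s w, v s w -> v w s;
  pt_triv : forall s w, Z s -> Z w -> ~ arc s w -> v s w;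
  pt_cross : forall x y z t, Z x -> Z y -> Z z -> Z t -> ccw4 x y z t ->
    v x z -> v y t -> v x y;
  pt_susp : forall s w, arc s w -> v s w -> v (pd s) (pd w) }.

Definition ends (v : plane R -> plane R -> Prop) s :=
  exists w, arc s w /\ v s w.

Section Ptolemy.
Variable v : plane R -> plane R -> Prop.
Hypothesis hv : ptolemy v.
Local Notation E := (ends v).

Lemma pt_lin l x y z t : L l -> Z x -> Z y -> Z z -> Z t ->
  ang l x < ang l y -> ang l y < ang l z -> ang l z < ang l t ->
  v x z -> v y t -> [/\ v x y, v y z, v z t & v x t].
Proof.
move=> Ll Zx Zy Zz Zt h1 h2 h3 v1 v2.
have o := ccw4_lin (L_circle hZ Ll) (Z_circle hZ Zx) (Z_circle hZ Zy)
  (Z_circle hZ Zz) (Z_circle hZ Zt) h1 h2 h3.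
have o2 := ccw4_rot o; have o3 := ccw4_rot o2; have o4 := ccw4_rot o3.
have v1' := pt_sym hv v1; have v2' := pt_sym hv v2.
split.
- exact: (pt_cross hv _ _ _ _ o).
- exact: (pt_cross hv _ _ _ _ o2).
- exact: (pt_cross hv _ _ _ _ o3).
- exact/(pt_sym hv)/(pt_cross hv _ _ _ _ o4).
Qed.

(* Going down one step at a time, {m^+, w} crosses its suspension {m, w^-}, and
   {m, w} is a side of the resulting quadrilateral. *)
Lemma pt_down l s' s w : seg Z l s' -> ang l s' <= ang l s -> arc s w -> v s w ->
  v s' w.
Proof.
move=> hs' ss' asw vsw; have [Zs Zw [nw1 nw2 nw3]] := asw.
apply: (@seg_ind _ _ hZ l s' s (fun m => v m w)) => // m hm ms IH.
have [Zm Ll _] := hm.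
have [amw|] := pselect (arc m w); last exact: (pt_triv hv).
have [_ _ [n1 n2 n3]] := amw.
have [e|ne] := eqVneq (ang l m) (ang l s).
  by rewrite (angL_inj hZ Ll Zm Zs e).
have {ne} ms' : ang l m < ang l s by rewrite lt_neqAle ne.
have Zm1 := Z_succ hZ Zm; have Zw' := Z_pred hZ Zw.
have lt1 := succ_gt hZ Ll Zm; have le1 := succ_le hZ Ll Zm Zs ms'.
have lt2 := pred_lt hZ Ll Zw; have lt3 := succ_gt hZ Ll Zw.
have vm1 : v (sc m) w by apply: IH.
(* Here {m^+, w} is not an arc and cannot be suspended. Since {s, w} is an arc, s lies at least two
   steps beyond w; the induction hypothesis gives {w^{++}, w}, whose double suspension is {w, m}. *)
have [e|ne] := pselect (sc m = pd w).
  have e1 : sc (sc m) = w by rewrite e predK.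
  have Zw1 := Z_succ hZ Zw; have Zw2 := Z_succ hZ Zw1.
  have lt4 := succ_gt hZ Ll Zw1.
  have sw : ang l (pd w) < ang l s.
    rewrite lt_neqAle -e le1 andbT e; apply/eqP => /(angL_inj hZ Ll Zw' Zs) e2.
    by apply: nw3; rewrite -e2 predK.
  have sw1 : ang l w < ang l s.
    have := succ_le hZ Ll Zw' Zs sw; rewrite predK // le_eqVlt => /predU1P[|//].
    by move=> /(angL_inj hZ Ll Zw Zs).
  have sw2 : ang l (sc w) < ang l s.
    have := succ_le hZ Ll Zw Zs sw1; rewrite le_eqVlt => /predU1P[|//].
    by move=> /(angL_inj hZ Ll Zw1 Zs) e2; case: nw1; rewrite -e2 succK.
  have vw2 : v (sc (sc w)) w.
    apply: IH => //; last exact: succ_le.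
    have : ang l (pd w) < ang l w by []. 
    by rewrite -e; lra.
  have a2 : arc (sc (sc w)) w by apply/arc_sym/(@arc_near l).
  have := pt_susp hv a2 vw2; have := arc_pred a2; rewrite succK // => a3 v3.
  have := pt_susp hv a3 v3; rewrite succK // -e succK //; exact: pt_sym.
have am1 : arc (sc m) w.
  split => //; split => [|e|e]; first by rewrite succK.
    by apply: n3; rewrite -e.
  by apply: ne; rewrite e succK.
have vm2 : v m (pd w) by have := pt_susp hv am1 vm1; rewrite succK.
have nw' : pd w <> m by move=> e; apply: n3; rewrite -e predK.
have [mw|wm] := ltP (ang l m) (ang l w).
  have l1 : ang l (sc m) < ang l (pd w).
    rewrite lt_neqAle (introN eqP (fun h => ne (angL_inj hZ Ll Zm1 Zw' h))) /=.
    apply: succ_le => //; rewrite lt_neqAle (pred_ge hZ) // andbT.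
    by apply/eqP => /(angL_inj hZ Ll Zm Zw') /esym.
  by have [] := pt_lin Ll Zm Zm1 Zw' Zw lt1 l1 lt2 vm2 vm1.
have {}wm : ang l w < ang l m.
  by rewrite lt_neqAle wm andbT; apply/eqP => /(angL_inj hZ Ll Zw Zm).
have [_ h _ _] := pt_lin Ll Zw' Zw Zm Zm1 lt2 wm lt1 (pt_sym hv vm2) (pt_sym hv vm1).
exact: (pt_sym hv).
Qed.

(** If the partner w of z lies between s and z, it is lowered to s. Otherwise z is lowered to s^+,
    and the suspension {s, w^-} of {s^+, w} crosses {z, w}, with {s, z} as a side. *)
Lemma ends_lower l s z : E z -> seg Z l s -> ang l s <= ang l z -> v s z.
Proof.
case=> w [azw vzw] hs sz; have [Zz Zw [n1 n2 n3]] := azw; have [Zs Ll _] := hs.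
have [e|ne] := eqVneq (ang l s) (ang l z).
  by rewrite (angL_inj hZ Ll Zs Zz e); apply: (pt_triv hv) => // -[_ _ []].
have {ne} sz' : ang l s < ang l z by rewrite lt_neqAle ne.
have [/andP[sw wz]|nb] := boolP (ang l s <= ang l w <= ang l z).
  exact: (pt_down hs sw (arc_sym azw) (pt_sym hv vzw)).
have Zs1 := Z_succ hZ Zs; have Zw' := Z_pred hZ Zw; have Zz1 := Z_succ hZ Zz.
have lt1 := succ_gt hZ Ll Zs; have le1 := succ_le hZ Ll Zs Zz sz'.
have lt2 := pred_lt hZ Ll Zw.
have as1 : arc (sc s) w.
  split => //; split => [e|e|e]; move: nb.
  - by rewrite e succK // lexx sz.
  - by rewrite e le1 ltW.
  - move: le1; rewrite le_eqVlt => /predU1P[|lt3].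
      by move=> /(angL_inj hZ Ll Zs1 Zz) e2; case: n3; rewrite -e2.
    have := succ_le hZ Ll Zs1 Zz lt3; have := succ_gt hZ Ll Zs1; rewrite -e.
    by move=> ? ->; rewrite andbT; lra.
have vs1 : v (sc s) w by apply: (pt_down _ le1 azw vzw); apply: seg_succ.
have vs2 : v s (pd w) by have := pt_susp hv as1 vs1; rewrite succK.
have [zw|wz] := ltP (ang l z) (ang l w).
  have l1 : ang l z < ang l (pd w).
    rewrite lt_neqAle (pred_ge hZ) // andbT; apply/eqP.
    by move=> /(angL_inj hZ Ll Zz Zw') e; apply: n3; rewrite e predK.
  by have [] := pt_lin Ll Zs Zz Zw' Zw sz' l1 lt2 vs2 vzw.
have ws : ang l w < ang l s by move: nb; lra.
by have [] := pt_lin Ll Zw' Zw Zs Zz lt2 ws sz' (pt_sym hv vs2) (pt_sym hv vzw).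
Qed.

Lemma pred2_arc s : Z s -> arc (pd (pd s)) s.
Proof.
move=> Zs; have [l Ll] := L_nonempty hZ; have Z1 := Z_pred hZ Zs.
apply: (@arc_near l) => //; first exact: Z_pred.
by rewrite predK //; exact: pred_lt.
Qed.

(** The partner of s is s^{--}, the nearest point below that spans an arc with it: {s^{--}, z} is in
    the family, and z is lowered to s. *)
Lemma ends_down l s z : E z -> seg Z l s -> ang l s <= ang l z -> E s.
Proof.
move=> Ez hs sz; have [Zs Ll _] := hs; have [w0 [[Zz _ _] _]] := Ez.
have Z1 := Z_pred hZ Zs; have lt1 := pred_lt hZ Ll Zs.
have lt2 := pred_lt hZ Ll Z1.
exists (pd (pd s)); split; first exact/arc_sym/pred2_arc.
have hs2 : seg Z l (pd (pd s)) by do 2 apply: (seg_pred hZ).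
have v2 : v (pd (pd s)) z by apply: (ends_lower Ez hs2); lra.
apply: (pt_down hs sz _ (pt_sym hv v2)); apply/arc_sym/(@arc_near l) => //.
  exact: Z_pred.
by rewrite predK //; lra.
Qed.

(** Lowering w in {w, u} gives {w^-, u}, which crosses {s, w} in this cyclic order and has {s, u} as
    a side of the quadrilateral. *)
Lemma pt_trans_aux s w u : arc s w -> arc w u -> s <> u -> v s w -> v w u ->
  ccw s w u -> v s u.
Proof.
move=> asw awu su vsw vwu o; have [Zs Zw [n1 n2 n3]] := asw.
have [_ Zu [n4 n5 n6]] := awu.
have [l sw] := seg_ex hZ Zw; have [_ Ll _] := sw.
have lt := pred_lt hZ Ll Zw; have Zw' := Z_pred hZ Zw.
have vpu : v (pd w) u by apply: (pt_down _ (ltW lt) awu vwu); exact: seg_pred.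
have ns : pd w <> s by move=> e; apply: n3; rewrite -e predK.
move: o => /(ccw_angL hZ Ll Zs Zw Zu) o.
have key : ang l s < ang l w -> ang l s < ang l (pd w).
  move=> h; rewrite lt_neqAle (pred_ge hZ) // andbT.
  by apply/eqP => /(angL_inj hZ Ll Zs Zw') /esym.
case/or3P: o => /andP[h1 h2].
- by have [] := pt_lin Ll Zs Zw' Zw Zu (key h1) lt h2 vsw vpu.
- have [_ _ h _] := pt_lin Ll Zw' Zw Zu Zs lt h1 h2 vpu (pt_sym hv vsw).
  exact: (pt_sym hv).
- have [h _ _ _] := pt_lin Ll Zu Zs Zw' Zw h1 (key h2) lt (pt_sym hv vpu) vsw.
  exact: (pt_sym hv).
Qed.

Lemma pt_trans s w u : arc s w -> arc w u -> s <> u -> v s w -> v w u -> v s u.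
Proof.
move=> asw awu su vsw vwu; have [Zs Zw [n5 n1 n6]] := asw.
have [Zw2 Zu [n3 n2 n4]] := awu; have [l Ll] := L_nonempty hZ.
have [cc|no] := pselect (ccw s w u); first exact: (pt_trans_aux asw awu).
apply: (pt_sym hv); apply: (@pt_trans_aux u w s) => //;
  [exact: arc_sym|exact: arc_sym|exact: nesym|exact: (pt_sym hv)|exact: (pt_sym hv)|].
apply/(ccw_angL hZ Ll) => //; apply/negbNE/negP => h; apply: no.
apply/(ccw_angL hZ Ll) => //; move: h.
have := angL_neq hZ Ll Zw Zs n1; have := angL_neq hZ Ll Zu Zw n2.
by have := angL_neq hZ Ll Zs Zu su; rewrite /cyc3; lra.
Qed.

(** Segments are named by the limit point at their upper end. The relation is reflexive only on
    segments that contain an end. *)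
Definition linked l1 l2 :=
  exists s w, [/\ seg Z l1 s, seg Z l2 w, arc s w & v s w].

Lemma linked_sym l1 l2 : linked l1 l2 -> linked l2 l1.
Proof.
by case=> s [w [h1 h2 /arc_sym h3 /(pt_sym hv) h4]]; exists w, s.
Qed.

Lemma linked_refl l z : E z -> seg Z l z -> linked l l.
Proof.
move=> Ez hz; have [Zz Ll _] := hz; exists (pd (pd z)), z; split => //.
- by do 2 apply: (seg_pred hZ).
- exact: pred2_arc.
- apply: (@ends_lower l) => //; first by do 2 apply: (seg_pred hZ).
  by have := pred_lt hZ Ll Zz; have := pred_lt hZ Ll (Z_pred hZ Zz); lra.
Qed.

Lemma pt_seg l s w : E s -> E w -> seg Z l s -> seg Z l w -> v s w.
Proof.
move=> Es Ew hs hw; have [h|h] := leP (ang l s) (ang l w).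
  exact: (ends_lower Ew hs h).
exact/(pt_sym hv)/(ends_lower Es hw)/ltW.
Qed.

(** Sliding down is [pt_down]. Sliding up goes through {s, w0^-} and {w0^-, w} by transitivity;
    starting from w0^- ensures that the second pair is an arc. *)
Lemma pt_slide l1 l2 s w0 w : seg Z l1 s -> seg Z l2 w0 -> seg Z l2 w ->
  l1 <> l2 -> v s w0 -> E w -> v s w.
Proof.
move=> hs hw0 hw l12 v0 Ew; have a0 := seg_arc hs hw0 l12.
have [Zw Ll _] := hw; have [Zw0 _ _] := hw0; have Z1 := Z_pred hZ Zw0.
have [h|h] := leP (ang l2 w) (ang l2 w0).
  exact/(pt_sym hv)/(pt_down hw h (arc_sym a0))/(pt_sym hv).
have lt0 := pred_lt hZ Ll Zw0; have hw1 := seg_pred hZ hw0.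
have a1 := seg_arc hs hw1 l12.
have v1 : v s (pd w0).
  exact/(pt_sym hv)/(pt_down hw1 (ltW lt0) (arc_sym a0))/(pt_sym hv).
apply: (pt_trans a1 _ _ v1).
- by apply: (@arc_near l2) => //; rewrite predK.
- by move=> e; apply: l12; rewrite -e in hw; exact: (seg_inj hZ) hs hw.
- by apply: (ends_lower Ew hw1); lra.
Qed.

Lemma linked_all l1 l2 s w : linked l1 l2 -> seg Z l1 s -> seg Z l2 w ->
  E s -> E w -> v s w.
Proof.
move=> [s0 [w0 [hs0 hw0 a0 v0]]] hs hw Es Ew.
have [e|ne] := eqVneq l1 l2; first by rewrite -e in hw; exact: pt_seg hs hw.
move/eqP: ne => ne; have v1 := pt_slide hs0 hw0 hw ne v0 Ew.
exact/(pt_sym hv)/(pt_slide hw hs0 hs (nesym ne) (pt_sym hv v1)).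
Qed.

Lemma arc_ends s w : arc s w -> v s w -> E s.
Proof. by exists w. Qed.

Lemma arc_ends_r s w : arc s w -> v s w -> E w.
Proof. by move=> /arc_sym a /(pt_sym hv) h; exists s. Qed.

Lemma linked_trans l1 l2 l3 : linked l1 l2 -> linked l2 l3 -> linked l1 l3.
Proof.
move=> h12 h23; have [s [w [hs hw a1 v1]]] := h12.
have [w' [u [hw' hu a2 v2]]] := h23.
have [e|/eqP n12] := eqVneq l1 l2; first by rewrite e.
have [e|/eqP n23] := eqVneq l2 l3; first by rewrite -e.
have [e|/eqP n13] := eqVneq l1 l3.
  by rewrite -e; apply: linked_refl hs; exact: arc_ends v1.
have vwu : v w u.
  by apply: (linked_all h23 hw hu); [exact: arc_ends_r v1|exact: arc_ends_r v2].
exists s, u; split => //; first exact: seg_arc hs hu n13.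
apply: (pt_trans a1 (seg_arc hw hu n23) _ v1 vwu) => e; apply: n13.
by rewrite -e in hu; exact: (seg_inj hZ) hs hu.
Qed.

End Ptolemy.

End Arcs.

(** * Maximal ends and the condition at limit points *)

Section Bounds.
Variables (R : realType) (Z : set (plane R)).
Hypothesis hZ : admissible Z.
Implicit Types (x y z b p q l s u w t : plane R).
Local Notation L := (limit_points Z).
Local Notation sc := (zsucc Z).
Local Notation pd := (zpred Z).

(* Besides closure under extensions and suspension, this is the only condition
   for a subcategory to be an aisle. *)
Definition crosses_limits (v : plane R -> plane R -> Prop) :=
  forall q, L q -> adh_left (ends Z v) q ->
  exists s s', [/\ seg Z q s, lseg Z q s', arc Z s s' & v s s'].

Lemma ends_Z v s : ends Z v s -> Z s.
Proof. by case=> w [[]]. Qed.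

Lemma left_gap q : L q ->
  exists p, [/\ circle p, p <> q & forall z, Z z -> ccw p z q -> seg Z q z].
Proof.
move=> Lq; have [p [cp pq h]] :=
  finite_left_gap (L_circle hZ) (finite_L hZ) (L_circle hZ Lq).
by exists p; split => // z Zz pzq; exact: (left_gap_seg hZ Lq cp).
Qed.

Lemma lseg_down q s z : lseg Z q s -> Z z -> ang q z <= ang q s -> lseg Z q z.
Proof.
case=> Zs Lq h Zz zs; split=> // l Ll; have cq := L_circle hZ Lq.
move=> /(ccw_ang cq cq (L_circle hZ Ll) (Z_circle hZ Zz)) qlz; apply: (h l Ll).
apply/(ccw_ang cq cq (L_circle hZ Ll) (Z_circle hZ Zs)); move: qlz.
by have := angL_gt0 hZ Lq Zz; rewrite angbb /cyc3; lra.
Qed.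

(** Change of base point: angles from the lower limit point [q] of a segment and from its upper
    limit point [r] order its points in the same way. *)
Lemma lseg_seg q r s z : lseg Z q s -> seg Z r s -> Z z -> ang q z <= ang q s ->
  seg Z r z /\ ang r z <= ang r s.
Proof.
move=> hs hr Zz zs; have [Zs Lq hq] := hs; have [_ Lr _] := hr.
have cq := L_circle hZ Lq; have cr := L_circle hZ Lr.
have cs := Z_circle hZ Zs; have cz := Z_circle hZ Zz.
have s0 := angL_gt0 hZ Lq Zs; have z0 := angL_gt0 hZ Lq Zz.
have r0 := ang_bounds cq cr.
have nqr : ~~ cyc3 0 (ang q r) (ang q s).
  by apply/negP; rewrite -(angbb q) => /(ccw_ang cq cq cr cs); exact: hq.
have rs : ang q r != ang q s.
  by apply/eqP => /(ang_inj cq cr cs) e; apply: (L_neqZ Lr Zs).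
have zr : ang q z != ang q r.
  by apply/eqP => /(ang_inj cq cz cr) e; apply: (L_neqZ Lr Zz).
split.
  apply: (nccw_seg hZ) => // l Ll; have cl := L_circle hZ Ll.
  move=> /(ccw_ang cq cz cl cr) zlr.
  have nql : ~~ cyc3 0 (ang q l) (ang q s).
    by apply/negP; rewrite -(angbb q) => /(ccw_ang cq cq cl cs); exact: hq.
  have nsl : ~~ cyc3 (ang q s) (ang q l) (ang q r).
    by apply/negP => /(ccw_ang cq cs cl cr); exact: (seg_nccw hZ hr Ll).
  have ls : ang q l != ang q s.
    by apply/eqP => /(ang_inj cq cl cs) e; apply: (L_neqZ Ll Zs).
  by move: zlr nql nsl nqr; have := ang_bounds cq cl; rewrite /cyc3; lra.
rewrite leNgt; apply/negP => lt.
have : ccw s z r.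
  apply/(ccw_ang cr cs cz cr); rewrite angbb /cyc3.
  by have := angL_gt0 hZ Lr Zs; lra.
by move=> /(ccw_ang cq cs cz cr); move: nqr; rewrite /cyc3; lra.
Qed.

Lemma lseg_left_L q s : lseg Z q s -> exists r, seg Z r s.
Proof. by case=> Zs _ _; exact: seg_ex. Qed.

Lemma near_right q a b : L q -> circle a -> circle b -> a <> q -> b <> q ->
  exists z, [/\ Z z, ang q z < ang q a & ang q z < ang q b].
Proof.
move=> Lq ca cb aq bq; have cq := L_circle hZ Lq.
have [c [cc cq' ha hb]] : exists c, [/\ circle c, c <> q,
    ang q c <= ang q a & ang q c <= ang q b].
  by have [h|/ltW h] := leP (ang q a) (ang q b); [exists a|exists b].
have [z Zz /(ccw_ang cq cq (Z_circle hZ Zz) cc)] := limit_right hZ Lq cc cq'.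
have := ang_gt0 cq cc cq'.
by rewrite angbb /cyc3 => c0 h; exists z; split=> //; lra.
Qed.

Lemma near_left q a b : L q -> circle a -> circle b -> a <> q -> b <> q ->
  exists z, [/\ circle z, z <> q, ang q a <= ang q z & ang q b <= ang q z].
Proof.
move=> Lq ca cb aq bq.
by have [/ltW h|h] := ltP (ang q a) (ang q b); [exists b|exists a].
Qed.

Section Bound.
Variable v : plane R -> plane R -> Prop.
Hypotheses (hv : ptolemy Z v) (lv : crosses_limits v).

Definition linked_ends l z :=
  exists m, [/\ seg Z m z, ends Z v z & linked Z v l m].

(** A supremum that is not attained is a limit point [q] whose left segment is exhausted by ends.
    The arc across [q] links the next segment to [l] as well; its ends descend to [q], so some of
    them lie beyond the supremum and still before [b]. *)
Lemma linked_ends_max l a b : Z a -> Z b ->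
  (exists2 z, linked_ends l z & ccw a z b) ->
  exists m, [/\ linked_ends l m, ccw a m b &
    forall z, linked_ends l z -> ccw a z b -> z = m \/ ccw a z m].
Proof.
move=> Za Zb [z0 lz0 az0b].
have ca := Z_circle hZ Za; have cb := Z_circle hZ Zb.
have leZ z : linked_ends l z -> Z z by case=> m [[]].
pose A := [set z | linked_ends l z /\ ccw a z b].
have [|||[q [lq aqb] mq]|[q [cq aq mq]]] := @sup_ang _ A a.
- by move=> z [/leZ /(Z_circle hZ)].
- by [].
- by exists z0.
- have Zq := leZ _ lq; have cq := Z_circle hZ Zq.
  exists q; split => // z lz azb; have Zz := leZ _ lz; have cz := Z_circle hZ Zz.
  have [e|ne] := eqVneq (ang a z) (ang a q); [left|right].
    exact: (ang_inj ca cz cq).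
  move: (azb) => /(ccw_ang ca ca cz cb); rewrite angbb => azb'.
  apply/(ccw_ang ca ca cz cq); rewrite angbb /cyc3.
  have := mq z (conj lz azb); have := ang_bounds ca cb.
  by move: azb'; rewrite /cyc3; lra.
have Lq : L q by apply: (adh_left_L hZ _ cq aq) => z [/leZ].
case: mq => [e|mq]; first by case: (L_notZ Lq); rewrite e.
have bq : b <> q by exact: (L_neqZ Lq Zb).
have qb : ang a q < ang a b.
  have [z Az] := aq b cb bq; have cz := Z_circle hZ (leZ _ Az.1).
  move=> /(ccw_ang ca cb cz cq); case: (Az) => _ /(ccw_ang ca ca cz cb).
  by have := mq z Az; rewrite angbb /cyc3; have := ang_bounds ca cb; lra.
have q0 : 0 < ang a q by apply: ang_gt0 => //; exact/nesym/(L_neqZ Lq Za).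
have [|s [s' [hs hs' ass' vss']]] := lv Lq.
  by move=> p cp pq; have [z [[m [_ Ez _]] _] h] := aq p cp pq; exists z.
have [p [cp pq hp]] := left_gap Lq.
have [z Az pzq] := aq p cp pq; have [[m [hm Ez lm]] azb] := Az.
have Zz := ends_Z Ez.
have mE : m = q by apply: (seg_inj hZ hm); apply: hp.
rewrite mE in lm hm.
have [r hr] := lseg_left_L hs'.
have lr : linked Z v l r.
  by apply: (linked_trans hZ hv lm); exists s, s'.
have [Zs' _ _] := hs'.
have [z' [Zz' z's z'b]] := near_right Lq (Z_circle hZ Zs') cb (L_neqZ Lq Zs') bq.
have [hz' rz'] := lseg_seg hs' hr Zz' (ltW z's).
have cz' := Z_circle hZ Zz'.
have : ccw q z' b.
  apply/(ccw_ang cq cq cz' cb); rewrite angbb /cyc3 z'b.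
  by rewrite (angL_gt0 hZ Lq Zz').
move=> /(ccw_ang ca cq cz' cb) qz'b.
have Az' : A z'.
  split.
    exists r; split => //; apply: (ends_down hZ hv _ hz' rz').
    exact: (arc_ends_r hZ hv ass').
  apply/(ccw_ang ca ca cz' cb); move: qz'b; rewrite angbb /cyc3.
  by have := ang_bounds ca cz'; lra.
by have := mq z' Az'; move: qz'b; rewrite /cyc3; lra.
Qed.

Lemma ccw4_arc s0 t0 s1 t1 : Z s0 -> Z t0 -> Z s1 -> Z t1 ->
  ccw4 s0 t0 s1 t1 -> arc Z s0 s1.
Proof.
move=> Zs0 Zt0 Zs1 Zt1 [k1 k2 k3 k4]; have [_ _ hs] := succP hZ Zs0.
have [_ _ hp] := predP hZ Zs0; split => //; split => e.
- by apply: (hp t1) => //; rewrite -e.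
- have [l Ll] := L_nonempty hZ; move: k1; rewrite e.
  by move=> /(ccw_angL hZ Ll Zs0 Zt0 Zs0); rewrite /cyc3; lra.
- by apply: (hs t0) => //; rewrite -e.
Qed.

(** Maps are detected by strict inequalities against t^+, factorisations by weak ones against t; for
    points of Z both say the same. *)
Lemma between_of_ccw a s m t : Z a -> Z s -> Z m -> Z t ->
  s = m \/ ccw a s m -> ccw a m (sc t) -> ccw a s (sc t) -> between s m t.
Proof.
move=> Za Zs Zm Zt sm mt st; have Zt1 := Z_succ hZ Zt.
case: sm => [->|sm]; first by constructor 1.
have [e|/eqP ne] := eqVneq m t; first by constructor 2.
constructor 3; have [l Ll] := L_nonempty hZ.
move: sm mt st => /(ccw_angL hZ Ll Za Zs Zm) sm /(ccw_angL hZ Ll Za Zm Zt1) mt.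
move=> /(ccw_angL hZ Ll Za Zs Zt1) st; apply/(ccw_angL hZ Ll Zs Zm Zt).
have := angL_neq hZ Ll Zm Zt ne; have := succ_gt hZ Ll Zt.
have := @succ_le _ _ hZ l Ll t a Zt Za; have := @succ_le _ _ hZ l Ll t s Zt Zs.
have := @succ_le _ _ hZ l Ll t m Zt Zm.
by move: sm mt st; rewrite /cyc3; lra.
Qed.

(* The arcs in [v] that map to the arc {t0, t1} are thus dominated by finitely
   many of them, one for each limit point [l]. *)
Lemma dominating_arc l t0 t1 (good := fun s0 s1 =>
    [/\ Z s0, Z s1, v s0 s1 & ccw4 s0 (sc t0) s1 (sc t1)]) :
  Z t0 -> Z t1 -> (exists s0 s1, seg Z l s0 /\ good s0 s1) ->
  exists m0 m1, good m0 m1 /\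
    forall s0 s1, seg Z l s0 -> good s0 s1 -> between s0 m0 t0 /\ between s1 m1 t1.
Proof.
move=> Zt0 Zt1 hex; have Z0 := Z_succ hZ Zt0; have Z1 := Z_succ hZ Zt1.
have gl s0 s1 : seg Z l s0 -> good s0 s1 ->
    [/\ linked_ends l s0, linked_ends l s1, ccw (sc t1) s0 (sc t0) &
        ccw (sc t0) s1 (sc t1)].
  move=> hs0 [Zs0 Zs1 vs cr]; have a := ccw4_arc Zs0 Z0 Zs1 Z1 cr.
  have E0 := arc_ends a vs; have E1 := arc_ends_r hZ hv a vs.
  have [m hm] := seg_ex hZ Zs1; case: cr => o1 o2 o3 o4; split => //.
  - exists l; split => //; exact: (linked_refl hZ hv E0).
  - by exists m; split => //; exists s0, s1.
have [s0 [s1 [hs0 gs]]] := hex; have [c0 c1 o0 o1] := gl _ _ hs0 gs.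
(* The two ends are maximised independently. Both segments are linked to [l], hence to each other,
   so [m0] and [m1] span an arc of the family. *)
have [|m0 [cm0 om0 mm0]] := @linked_ends_max l _ _ Z1 Z0; first by exists s0.
have [|m1 [cm1 om1 mm1]] := @linked_ends_max l _ _ Z0 Z1; first by exists s1.
have [k0 [hk0 E0 l0]] := cm0; have [k1 [hk1 E1 l1]] := cm1.
have Zm0 := ends_Z E0; have Zm1 := ends_Z E1.
exists m0, m1; split.
  split => //.
    apply: (linked_all hZ hv _ hk0 hk1) => //.
    exact: (linked_trans hZ hv (linked_sym hZ hv l0) l1).
  have [d Ld] := L_nonempty hZ; move: om0 om1.
  move=> /(ccw_angL hZ Ld Z1 Zm0 Z0) om0 /(ccw_angL hZ Ld Z0 Zm1 Z1) om1.
  by split; apply/(ccw_angL hZ Ld) => //; move: om0 om1; rewrite /cyc3; lra.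
move=> u0 u1 hu0 gu; have [d0 d1 p0 p1] := gl _ _ hu0 gu.
have [Zu0 Zu1 _ _] := gu.
split.
  by apply: (between_of_ccw Z1) => //; exact: mm0.
by apply: (between_of_ccw Z0) => //; exact: mm1.
Qed.

End Bound.

(** The arcs that the two families provide across [q] may differ, but ends descend and links do not
    depend on the chosen ends, so both families contain an arc {m, n} with m and n low enough. *)
Lemma crosses_limits_cap v v' : ptolemy Z v -> ptolemy Z v' ->
  crosses_limits v -> crosses_limits v' ->
  crosses_limits (fun s w => v s w /\ v' s w).
Proof.
move=> hv hv' lv lv' q Lq aE; have cq := L_circle hZ Lq.
have aEv : adh_left (ends Z v) q.
  by move=> p cp pq; have [z [w [a [h _]]] o] := aE p cp pq; exists z => //; exists w.
have aEv' : adh_left (ends Z v') q.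
  by move=> p cp pq; have [z [w [a [_ h]]] o] := aE p cp pq; exists z => //; exists w.
have [s [s' [hs hs' a vss]]] := lv q Lq aEv.
have [t [t' [ht ht' a' vtt]]] := lv' q Lq aEv'.
have [Zs _ _] := hs; have [Zs' _ _] := hs'.
have [Zt _ _] := ht; have [Zt' _ _] := ht'.
have [m [Zm hm ms mt]] : exists m, [/\ Z m, seg Z q m, ang q m <= ang q s &
    ang q m <= ang q t].
  by have [h|/ltW h] := leP (ang q s) (ang q t); [exists s|exists t].
have Z1 := Z_pred hZ Zm; have Z2 := Z_pred hZ Z1.
have [n0 [Zn0 n0s n0t]] := near_right Lq (Z_circle hZ Zs') (Z_circle hZ Zt')
  (L_neqZ Lq Zs') (L_neqZ Lq Zt').
(* If [q] is the only limit point, m and n lie in the same segment; n before m^{--} keeps them from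
   being neighbours. *)
have [n [Zn nn0 nm]] := near_right Lq (Z_circle hZ Zn0) (Z_circle hZ Z2)
  (L_neqZ Lq Zn0) (L_neqZ Lq Z2).
have amn : arc Z m n.
  apply: arc_sym => //; apply: (@arc_near _ _ hZ q) => //.
  have := succ_le hZ Lq Zn Z2 nm; have := pred_lt hZ Lq Z1.
  by have := pred_lt hZ Lq Zm; lra.
have key vv s1 s1' : ptolemy Z vv -> seg Z q s1 -> lseg Z q s1' -> arc Z s1 s1' ->
    vv s1 s1' -> ang q m <= ang q s1 -> ang q n <= ang q s1' -> vv m n.
  move=> hu h1 h1' ar us m1 n1; have [r hr] := lseg_left_L h1'.
  have [hn rn] := lseg_seg h1' hr Zn n1.
  have Em : ends Z vv m by apply: (ends_down hZ hu _ hm m1); exists s1'.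
  have En : ends Z vv n.
    by apply: (ends_down hZ hu _ hn rn); exact: (arc_ends_r hZ hu ar).
  by apply: (linked_all hZ hu _ hm hn Em En); exists s1, s1'.
exists m, n; split => //; first by apply: (lseg_down hs') => //; lra.
split; first by apply: (key v s s') => //; lra.
by apply: (key v' t t') => //; lra.
Qed.

Lemma adh_left_cup (A B : set (plane R)) q : A `<=` Z -> B `<=` Z -> L q ->
  adh_left (A `|` B) q -> adh_left A q \/ adh_left B q.
Proof.
move=> AZ BZ Lq aAB; have cq := L_circle hZ Lq; apply: contrapT.
move=> /not_orP[/existsNP[p /not_implyP[cp /not_implyP[pq nA]]]].
move=> /existsNP[r /not_implyP[cr /not_implyP[rq nB]]].
have [c [cc cq' pc rc]] := near_left Lq cp cr pq rq.
have [z ABz czq] := aAB c cc cq'.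
have Zz : Z z by case: ABz => [/AZ|/BZ].
have cz := Z_circle hZ Zz.
have h : forall a, circle a -> a <> q -> ang q a <= ang q c -> ccw a z q.
  move=> a ca aq ac; move: czq => /(ccw_ang cq cc cz cq) czq.
  apply/(ccw_ang cq ca cz cq); move: czq; rewrite angbb /cyc3.
  by have := ang_gt0 cq ca aq; lra.
by case: ABz => hz; [apply: nA|apply: nB]; exists z => //; apply: h.
Qed.

End Bounds.

(** * Approximations in the cluster category *)

Section Decompositions.
Variables (K : fieldType) (C : linear_category K).
Implicit Types X Y : C.

Lemma iso_neq0l X X' Y (a : hom X' X) (f : hom X Y) :
  is_iso a -> f \oc a = 0 -> f = 0.
Proof.
by case=> b ba ab /(congr1 (fun h => h \oc b)); rewrite -compmA ab compm1 comp0l.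
Qed.

Lemma iso_neq0r X Y Y' (a : hom Y Y') (f : hom X Y) :
  is_iso a -> a \oc f = 0 -> f = 0.
Proof.
by case=> b ba ab /(congr1 (fun h => b \oc h)); rewrite compmA ba comp1m comp0r.
Qed.

Lemma isomorphic_zero X Y : isomorphic X Y -> is_zero X -> is_zero Y.
Proof.
by case=> f [g gf fg] X0; rewrite /is_zero -fg (zero_hom_from f X0) comp0l.
Qed.

(** One of two complementary idempotents is invertible; it annihilates the other, whose summand is
    therefore zero. *)
Lemma local_end_indecomposable X : local_end X -> indecomposable X.
Proof.
case=> X0 loc; split => // Y [inc [prj [h1 h0 hs]]].
have sum2 : (inc true \oc prj true) + (inc false \oc prj false) = idm X.
  by rewrite -hs big_bool.
have key b : is_iso (inc b \oc prj b) -> is_zero (Y (~~ b)).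
  move=> iso; suff p0 : prj (~~ b) = 0 by rewrite /is_zero -h1 p0 comp0l.
  by apply: (iso_neq0l iso); rewrite compmA h0 ?comp0l //; case: b {iso}.
have [iso|iso] := loc (inc true \oc prj true).
  by exists false; exact: (key true).
by exists true; apply: (key false); rewrite -sum2 addrC addKr in iso.
Qed.

Lemma direct_sum_iso (I : finType) (Y Y' : I -> C) X :
  (forall i, isomorphic (Y i) (Y' i)) -> direct_sum Y X -> direct_sum Y' X.
Proof.
move=> iso [inc [prj [h1 h0 hs]]].
have {iso} iso i : {fg : hom (Y i) (Y' i) * hom (Y' i) (Y i) |
    fg.2 \oc fg.1 = idm _ /\ fg.1 \oc fg.2 = idm _}.
  by apply: cid; have [f [g gf fg]] := iso i; exists (f, g).
exists (fun i => inc i \oc (sval (iso i)).2), (fun i => (sval (iso i)).1 \oc prj i).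
split=> [i|i j ij|].
- case: (iso i) => -[f g] /= [gf fg].
  by rewrite compmA -(compmA f) h1 compm1.
- by rewrite compmA -(compmA _ (prj j)) h0 // comp0r comp0l.
- rewrite -[RHS]hs; apply: eq_bigr => i _; case: (iso i) => -[f g] /= [gf fg].
  by rewrite compmA -(compmA (inc i)) gf compm1.
Qed.

Definition lperp (N : set C) : set C :=
  [set A | forall B, N B -> forall f : hom A B, f = 0].

Lemma lperp_subcategory (N : set C) : subcategory (lperp N).
Proof.
move=> I Y X [inc [prj [h1 h0 hs]]]; split => [pX i B NB f|pY B NB f].
  by rewrite -(compm1 f) -h1 compmA (pX _ NB (f \oc prj i)) comp0l.
rewrite -(compm1 f) -hs comp_sumr big1 // => i _.
by rewrite compmA (pY i _ NB (f \oc inc i)) comp0l.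
Qed.

End Decompositions.

Lemma lperp_ext_closed (K : fieldType) (C : triangulated_category K)
  (N : set C) : ext_closed (lperp N).
Proof.
move=> X Y Z u v w t pX pZ B NB f.
have [|h <-] := @dist_extend _ _ _ _ _ _ _ _ ((dist_rot _ _ _).1 t) B f.
  by rewrite compNr -suspmM (pX _ NB (f \oc u)) suspm0 oppr0.
by rewrite (pZ _ NB h) comp0l.
Qed.

Section Precovers.
Variables (K : fieldType) (C : triangulated_category K) (V : set C).
Hypothesis hV : subcategory V.

Lemma precover_direct_sum (I : finType) (Y : I -> C) T : direct_sum Y T ->
  (forall i, exists X (c : hom X (Y i)), precover V c) ->
  exists X (c : hom X T), precover V c.
Proof.
move=> [inc [prj [h1 h0 hs]]] hp.
pose X i := sval (cid (hp i)); have hX i := svalP (cid (hp i)).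
pose c i := sval (cid (hX i)); have hc i : precover V (c i) := svalP (cid (hX i)).
have [A [incA [prjA [hA1 hA0 hAs]]]] := tcat_additive X.
have VA : V A.
  have dA : direct_sum X A by exists incA, prjA.
  by apply/(hV dA) => i; case: (hc i).
exists A, (\sum_i (inc i \oc (c i \oc prjA i))); split => // S g VS.
have hk i : exists k, c i \oc k = prj i \oc g by case: (hc i) => _; apply.
pose k i := sval (cid (hk i)).
have kE i : c i \oc k i = prj i \oc g := svalP (cid (hk i)).
exists (\sum_i (incA i \oc k i)).
rewrite comp_suml -[RHS]comp1m -hs comp_suml; apply: eq_bigr => i _.
rewrite comp_sumr (bigD1 i) //= big1 => [|j /eqP ji].
  rewrite addr0 -!compmA (compmA (prjA i)) hA1 comp1m.
  by rewrite -kE compmA.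
by rewrite -!compmA (compmA (prjA i)) hA0 // comp0l !comp0r.
Qed.

End Precovers.

Section ClusterCategory.
Variables (K : fieldType) (R : realType) (Z : set (plane R)).
Hypothesis hZ : admissible Z.
Variables (C : triangulated_category K) (M : set (plane R) -> C).
Hypothesis hC : discrete_cluster_category Z M.
Local Notation L := (limit_points Z).
Local Notation sc := (zsucc Z).
Local Notation pd := (zpred Z).
Local Notation arc := (arc Z).

Lemma arc_M s w : arc s w -> is_arc Z [set s; w].
Proof. by move=> a; have [Zs Zw _] := a; apply/(is_arcE hZ). Qed.

Lemma isomorphic_arc A s w : is_arc Z A -> Z s -> Z w ->
  isomorphic (M A) (M [set s; w]) -> arc s w /\ A = [set s; w].
Proof.
move=> aA Zs Zw iso; have [a|na] := pselect (is_arc Z [set s; w]).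
  split; first by apply/(is_arcE hZ).
  exact: (dcc_inj hC).
have [nz _] := dcc_indecomposable hC aA; case: nz.
exact: isomorphic_zero (isomorphic_sym iso) (dcc_not_arc hC na).
Qed.

Lemma arc_decomposition X : exists (I : finType) (B : I -> set (plane R)),
  direct_sum (fun i => M (B i)) X /\ forall i, is_arc Z (B i).
Proof.
have [I [Y [dX loc]]] := dcc_krull_schmidt hC X.
have hB i : exists A, is_arc Z A /\ isomorphic (Y i) (M A).
  have [A aA iso] := dcc_surj hC (local_end_indecomposable (loc i)).
  by exists A.
have [B hB'] := choice hB.
exists I, B; split => [|i]; last by case: (hB' i).
by apply: direct_sum_iso dX => i; case: (hB' i).
Qed.

Lemma crosses_arc s w t u : Z s -> Z w -> Z t -> Z u -> crosses s w t u ->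
  arc s w /\ arc t u.
Proof.
move=> Zs Zw Zt Zu [c|c].
  split; first by apply: (ccw4_arc hZ _ _ _ _ c).
  by apply: (ccw4_arc hZ _ _ _ _ (ccw4_rot c)).
split; first by apply: (ccw4_arc hZ _ _ _ _ c).
by apply: arc_sym => //; apply: (ccw4_arc hZ _ _ _ _ (ccw4_rot c)).
Qed.

Lemma hom_cross_line s w t u : arc s w -> arc t u -> crosses s w t u ->
  exists f : hom (M [set s; w]) (susp (M [set t; u])), f <> 0 /\
    forall g, exists c, g = c *: f.
Proof.
move=> a b cr; have [phi [psi h1 h2]] := dcc_hom_cross hC (arc_M a) (arc_M b) cr.
exists (psi 1); split => [e|g].
  by have := h2 1; rewrite e linear0 => /esym /eqP; rewrite oner_eq0.
exists (phi g); apply: (can_inj h1).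
by rewrite linearZ /= h2 /GRing.scale /= mulr1.
Qed.

Lemma susp_arc t u : arc t u ->
  isomorphic (susp (M [set sc t; sc u])) (M [set t; u]).
Proof.
move=> a; have [Zt Zu _] := a.
have := dcc_susp hC (arc_M (arc_succ hZ a)).
by rewrite !succK.
Qed.

(** The target is the suspension of its successor arc; this is the source of the successors in all
    conditions on maps between arcs. *)
Lemma hom_arc_crosses s w t u : arc s w -> arc t u ->
  forall f : hom (M [set s; w]) (M [set t; u]), f <> 0 ->
  crosses s w (sc t) (sc u).
Proof.
move=> a b f f0; apply: contrapT => ncr; apply: f0.
have [h hiso] := isomorphic_sym (susp_arc b).
apply: (iso_neq0r hiso).
exact: (dcc_hom_ncross hC (arc_M a) (arc_M (arc_succ hZ b)) ncr).
Qed.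

Lemma hom_arc_neq0 s w t u : arc s w -> arc t u -> crosses s w (sc t) (sc u) ->
  exists f : hom (M [set s; w]) (M [set t; u]), f <> 0.
Proof.
move=> a b cr; have [f [f0 _]] := hom_cross_line a (arc_succ hZ b) cr.
have [h hiso] := susp_arc b; exists (h \oc f) => e; apply: f0.
exact: (iso_neq0r hiso).
Qed.

Lemma hom_arc_line A B : is_arc Z B ->
  exists f : hom (M A) (M B), forall g, exists c, g = c *: f.
Proof.
move=> bB; have [aA|nA] := pselect (is_arc Z A); last first.
  exists 0 => g; exists 0; rewrite scaler0.
  exact: zero_hom_from (dcc_not_arc hC nA).
case: aA => s [w [Zs Zw -> nA]]; case: bB => t [u [Zt Zu -> nB]].
have a : arc s w by case: nA.
have b : arc t u by case: nB.
have [cr|ncr] := pselect (crosses s w (sc t) (sc u)); last first.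
  exists 0 => g; exists 0; rewrite scaler0; apply: contrapT => g0.
  exact/ncr/(hom_arc_crosses a b g0).
have [f [_ fl]] := hom_cross_line a (arc_succ hZ b) cr.
have [h [k kh hk]] := susp_arc b; exists (h \oc f) => g.
have [c cE] := fl (k \oc g); exists c.
by rewrite -compZr -cE compmA hk comp1m.
Qed.

Section Subcategories.
Variable V : set C.
Hypotheses (hV : subcategory V) (eV : ext_closed V) (sV : susp_closed V).

Definition arcs_in (U : set C) s w := U (M [set s; w]).

Lemma arcs_in_ptolemy : ptolemy Z (arcs_in V).
Proof.
split.
- by move=> s w; rewrite /arcs_in setUC.
- move=> s w Zs Zw na; apply: (subcat_zero hV); apply: (dcc_not_arc hC).
  by move=> /(is_arcE hZ Zs Zw).
- move=> x y z t Zx Zy Zz Zt c v1 v2.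
  have cr : crosses x z y t by left.
  have [a b] := crosses_arc Zx Zz Zy Zt cr.
  have [f [f0 _]] := hom_cross_line a b cr.
  have [W [inc [prj [p [q [bi d _]]]]]] := dcc_triangle hC (arc_M a) (arc_M b) c f0.
  have VW : V W by exact: eV d v2 v1.
  have dW : direct_sum (fun b : bool => if b then M [set x; y] else M [set z; t]) W.
    by exists inc, prj.
  exact: ((hV dW).1 VW true).
- move=> s w a v; have := sV v.
  exact: (subcat_iso hV (dcc_susp hC (arc_M a))).
Qed.

Hypothesis cV : crosses_limits Z (arcs_in V).

Lemma precover_lift_arcs X T (c : hom X T) : V X ->
  (forall s w, arc s w -> arcs_in V s w ->
     forall g : hom (M [set s; w]) T, exists h, c \oc h = g) ->
  precover V c.
Proof.
move=> VX hl; split => // S g VS.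
have [I [B [dS aB]]] := arc_decomposition S.
have VB := (hV dS).1 VS; have [inc [prj [h1 h0 hs]]] := dS.
have hk i : exists k, c \oc k = g \oc inc i.
  have [s [w [Zs Zw BE n]]] := aB i; have aw : arc s w by case: n.
  by move: (inc i) (VB i); rewrite BE => ii VM; apply: hl.
pose k i := sval (cid (hk i)).
have kE i : c \oc k i = g \oc inc i := svalP (cid (hk i)).
exists (\sum_i (k i \oc prj i)).
rewrite comp_sumr -[RHS]compm1 -hs comp_sumr; apply: eq_bigr => i _.
by rewrite !compmA kE.
Qed.

Lemma set0_not_arc : ~ is_arc Z set0.
Proof.
case=> s [w [_ _ e _]]; have : [set s; w] s by left.
by rewrite -e.
Qed.

(** The approximation is the sum, over the limit points, of the dominating arcs. A map from an arc
    of [V] factors through the one for the segment of its first end, and the second factor is a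
    multiple of the generator [h i] of a Hom space of dimension at most one. *)
Lemma arc_precover t u : arc t u ->
  exists X (c : hom X (M [set t; u])), precover V c.
Proof.
move=> atu; have [Zt Zu _] := atu; have hv := arcs_in_ptolemy.
pose good s0 s1 := [/\ Z s0, Z s1, arcs_in V s0 s1 & ccw4 s0 (sc t) s1 (sc u)].
have [ls /= lsE] := (finite_seqP _).1 (finite_L hZ).
pose l (i : 'I_(size ls)) := nth t ls i.
have hA i : exists A, V (M A) /\ forall s0 s1, seg Z (l i) s0 -> good s0 s1 ->
    exists m0 m1, [/\ A = [set m0; m1], arc m0 m1, between s0 m0 t & between s1 m1 u].
  have [ex|nex] := pselect (exists s0 s1, seg Z (l i) s0 /\ good s0 s1).
    have [m0 [m1 [[Zm0 Zm1 vm cm] hm]]] := dominating_arc hZ hv cV Zt Zu ex.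
    exists [set m0; m1]; split => // s0 s1 hs0 /(hm s0 s1 hs0) [b0 b1].
    exists m0, m1; split => //.
    by apply: (ccw4_arc hZ _ _ _ _ cm) => //; exact: Z_succ.
  (* Where no arc is to be dominated, [set0] contributes a zero summand. *)
  exists set0; split; first exact: (subcat_zero hV (dcc_not_arc hC set0_not_arc)).
  by move=> s0 s1 hs0 g; case: nex; exists s0, s1.
have [A {}hA] := choice hA.
have hh i : exists f : hom (M (A i)) (M [set t; u]), forall g, exists c, g = c *: f.
  exact: hom_arc_line (arc_M atu).
pose h i := sval (cid (hh i)).
have hE i : forall g, exists c, g = c *: h i := svalP (cid (hh i)).
have [X dX] := tcat_additive (fun i => M (A i)).
have VX : V X by apply/(hV dX) => i; case: (hA i).
case: dX => inc [prj [h1 h0 hs]].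
exists X, (\sum_i (h i \oc prj i)); apply: precover_lift_arcs => //.
have key i k : (\sum_i (h i \oc prj i)) \oc (inc i \oc k) = h i \oc k.
  rewrite comp_suml (bigD1 i) //= big1 => [|j /eqP ji].
    by rewrite addr0 -compmA (compmA (prj i)) h1 comp1m.
  by rewrite -compmA (compmA (prj j)) h0 ?comp0l ?comp0r //; exact: nesym.
have main s w : arc s w -> arcs_in V s w -> ccw4 s (sc t) w (sc u) ->
    forall g : hom (M [set s; w]) (M [set t; u]), g <> 0 ->
    exists k, (\sum_i (h i \oc prj i)) \oc k = g.
  move=> asw vsw c4 g g0; have [Zs Zw _] := asw.
  have [l0 hl0] := seg_ex hZ Zs; have [_ Ll0 _] := hl0.
  have l0s : l0 \in ls by have : [set` ls] l0 by rewrite -lsE.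
  pose i := Ordinal (etrans (index_mem l0 ls) l0s).
  have li : l i = l0 by rewrite /l nth_index.
  have [|m0 [m1 [AE am b0 b1]]] := (hA i).2 s w _ (And4 Zs Zw vsw c4).
    by rewrite li.
  have [Zm0 Zm1 _] := am.
  have mind : indecomposable (M (A i)).
    by rewrite AE; apply: (dcc_indecomposable hC); exact: arc_M.
  have [_ fac] := dcc_factor hC (arc_M asw) (arc_M atu) c4 g0 mind.
  have [|k [h' gE]] := fac.
    by exists m0, m1; split => //; rewrite AE; exact: isomorphic_refl.
  have [c cE] := hE i h'; exists (inc i \oc (c *: k)).
  by rewrite key gE cE compZr compZl.
move=> s w asw vsw g; have [g0|/eqP g0] := eqVneq g 0.
  by exists 0; rewrite g0 comp0r.
(* The two forms of crossing differ by exchanging the ends of {s, w}. *)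
have [c4|c4] := hom_arc_crosses asw atu g0; first exact: main.
move: g g0; rewrite setUC => g g0; apply: main => //; first exact: arc_sym.
  exact: (pt_sym hv).
exact/ccw4_rot/ccw4_rot.
Qed.

Lemma cluster_t_structure : exists T : t_structure C, aisle T = V.
Proof.
apply: (precover_t_structure hV eV sV (dcc_krull_schmidt hC)) => T.
have [I [B [dT aB]]] := arc_decomposition T.
apply: (precover_direct_sum hV dT) => i.
have [s [w [Zs Zw -> n]]] := aB i; apply: arc_precover.
by case: n.
Qed.

End Subcategories.
End ClusterCategory.

(** * Intersections of aisles *)

Lemma right_gap (R : realType) (Z : set (plane R)) q : admissible Z ->
  limit_points Z q -> exists a, [/\ circle a, a <> q &
    forall z, Z z -> ang q z < ang q a -> lseg Z q z].
Proof.
move=> hZ Lq; have cq := L_circle hZ Lq.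
have lsegP z : Z z -> (forall l, limit_points Z l -> l <> q -> ~ ccw q l z) ->
    lseg Z q z.
  move=> Zz h; split => // l Ll; have [e|/eqP] := eqVneq l q; last exact: h.
  by rewrite e => /(ccw_ang cq cq cq (Z_circle hZ Zz)); rewrite /cyc3; lra.
pose F := [set l | limit_points Z l /\ l <> q].
have [ne|nF] := pselect (F !=set0).
  have [||l [Ll lq] lm] := @finite_next _ F q _ _ ne.
  - by move=> l [/(L_circle hZ)].
  - by apply: sub_finite_set (finite_L hZ) => l [].
  exists l; split => //; first exact: (L_circle hZ).
  move=> z Zz zl; apply: lsegP => // l' Ll' l'q.
  move=> /(ccw_ang cq cq (L_circle hZ Ll') (Z_circle hZ Zz)).
  have := lm l' (conj Ll' l'q); have := angL_gt0 hZ Lq Zz.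
  by rewrite angbb /cyc3; lra.
have pi0 := @pi_gt0 R.
(* With [q] as the only limit point, every other point of the circle would do. *)
exists (cis (arg q + pi)); split; first exact: cis_circle.
  by move=> /(congr1 (ang q)); rewrite angbb ang_cis // ?(mulr2n pi); lra.
by move=> z Zz _; apply: lsegP => // l Ll lq; case: nF; exists l.
Qed.

Section ClusterTStructures.
Variables (K : fieldType) (R : realType) (Z : set (plane R)).
Hypothesis hZ : admissible Z.
Variables (C : triangulated_category K) (M : set (plane R) -> C).
Hypothesis hC : discrete_cluster_category Z M.
Local Notation L := (limit_points Z).
Local Notation sc := (zsucc Z).
Local Notation pd := (zpred Z).
Local Notation arc := (arc Z).
Local Notation arcs_in := (arcs_in M).
Local Notation E V := (ends Z (arcs_in V)).

Lemma aisle_susp_closed (T : t_structure C) : susp_closed (aisle T).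
Proof. exact: t_structure_susp. Qed.

Lemma aisle_ptolemy (T : t_structure C) : ptolemy Z (arcs_in (aisle T)).
Proof.
apply: (arcs_in_ptolemy hZ hC); first exact: aisle_subcategory.
  exact: aisle_ext_closed.
exact: aisle_susp_closed.
Qed.

(* Fix an end [w] in the segment on the left of [q] and a point [t] just to the
   right of [q].  The maps from the objects {s, w} to {t, w}, for s tending to
   [q], all factor through one approximation, which has finitely many summands;
   a summand {s', w} with s' beyond all s is the required arc. *)
Lemma aisle_crosses_limits (T : t_structure C) :
  crosses_limits Z (arcs_in (aisle T)).
Proof.
move=> q Lq aE; have cq := L_circle hZ Lq; have hv := aisle_ptolemy T.
have hV := aisle_subcategory T.
have [p [cp pq hp]] := left_gap hZ Lq.
have [w Ew pwq] := aE p cp pq; have Zw := ends_Z Ew; have hw := hp w Zw pwq.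
have cw := Z_circle hZ Zw.
have [a [ca aq ha]] := right_gap hZ Lq.
have Zw1 := Z_pred hZ Zw; have Zw2 := Z_pred hZ Zw1.
have [t [Zt ta tw]] := near_right hZ Lq ca (Z_circle hZ Zw2) aq (L_neqZ Lq Zw2).
have lt1 := pred_lt hZ Lq Zw; have lt2 := pred_lt hZ Lq Zw1.
have Zt1 := Z_succ hZ Zt; have Zws := Z_succ hZ Zw.
have t1w := succ_le hZ Lq Zt Zw2 tw; have lt3 := succ_gt hZ Lq Zt.
have lt4 := succ_gt hZ Lq Zw.
have atw : arc t w by apply: (@arc_near _ _ hZ q) => //; lra.
have [X [c [VX hc]]] := aisle_precover T (M [set t; w]).
have [I [B [dX aB]]] := arc_decomposition hC X.
have VB := (hV _ _ _ dX).1 VX.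
have [inc [prj [h1 h0 hs]]] := dX.
(* The partners of [w] among the summands: being finitely many, they leave a gap just before [q], in
   which [s] will be chosen. *)
pose F := [set z | [/\ Z z, z <> w & exists i, B i = [set z; w]]].
have Fc : F `<=` @circle R by move=> z [/(Z_circle hZ)].
have finF : finite_set F.
  pose other i := xget w [set z | z <> w /\ B i = [set z; w]].
  apply: (@sub_finite_set _ _ (other @` setT)); last first.
    exact/finite_image/finite_finset.
  move=> z [Zz zw [i Bi]]; exists i => //; rewrite /other.
  have ex : exists z', [set z | z <> w /\ B i = [set z; w]] z' by exists z.
  have [] := xgetPex w ex; set z' := xget _ _ => z'w e.
  have : [set z'; w] z by rewrite -e Bi; left.
  by case.
have [p1 [cp1 p1q hp1]] := finite_left_gap Fc finF cq.
have [c1 [cc1 c1q pc1 p1c1]] := near_left Lq cp cp1 pq p1q.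
have [c2 [cc2 c2q c12 wc2]] := near_left Lq cc1 (Z_circle hZ Zws) c1q (L_neqZ Lq Zws).
have [s Es c2sq] := aE c2 cc2 c2q; have Zs := ends_Z Es.
have cs := Z_circle hZ Zs.
have c2s : ang q c2 < ang q s.
  move: c2sq => /(ccw_ang cq cc2 cs cq); rewrite angbb /cyc3.
  by have := ang_gt0 cq cc2 c2q; have := angL_gt0 hZ Lq Zs; lra.
have hs_ : seg Z q s by apply: (seg_up hw) => //; lra.
have asw : arc s w by apply: arc_sym => //; apply: (@arc_near _ _ hZ q) => //; lra.
have vsw : arcs_in (aisle T) s w by exact: (pt_seg hZ hv Es Ew hs_ hw).
have c4 : ccw4 s (sc t) w (sc w).
  do 3 apply: ccw4_rot.
  apply: (ccw4_lin cq (Z_circle hZ Zt1) cw (Z_circle hZ Zws) cs) => //; lra.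
have [f f0] := hom_arc_neq0 hZ hC asw atw (or_introl c4).
have [g gE] := hc _ f vsw.
have [i fi0] : exists i, (c \oc inc i) \oc (prj i \oc g) <> 0.
  apply: contrapT => /forallNP nf; apply: f0.
  rewrite -gE -[g]comp1m -hs comp_suml comp_sumr big1 // => i _.
  by have := nf i => /contrapT; rewrite !compmA.
have Bind := dcc_indecomposable hC (aB i).
have [fac _] := dcc_factor hC (arc_M hZ asw) (arc_M hZ atw) c4 fi0 Bind.
have [|s0 [s1 [Zs0 Zs1 iso b0 b1]]] := fac.
  by exists (prj i \oc g), (c \oc inc i).
have s1w : s1 = w.
  case: b1 => // /(ccw_ang cq cw (Z_circle hZ Zs1) cw).
  by apply: contraTeq => _; rewrite /cyc3; lra.
rewrite s1w in iso; have [as0w BE] := isomorphic_arc hZ hC (aB i) Zs0 Zw iso.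
have Fs0 : F s0.
  split => //; last by exists i.
  by case: as0w => _ _ [_ /nesym].
(* Anti-clockwise from [s] to [t] one passes [q]. As [s] lies in the gap of [F], the partner [s0]
   cannot come before [q], so it lies between [q] and [t]. *)
have s0t : ang q s0 <= ang q t.
  rewrite leNgt; apply/negP => lt; apply: (hp1 s0 Fs0).
  apply/(ccw_ang cq cp1 (Z_circle hZ Zs0) cq); rewrite angbb /cyc3.
  have := ang_gt0 cq cp1 p1q.
  case: b0 => [->|e|/(ccw_ang cq cs (Z_circle hZ Zs0) (Z_circle hZ Zt))].
  - by lra.
  - by move: lt; rewrite e ltxx.
  - by rewrite /cyc3; lra.
exists w, s0; split => //.
- by apply: ha => //; lra.
- by apply: arc_sym.
- by rewrite /arcs_in setUC -BE; exact: VB.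
Qed.

Lemma t_structure_eq (T T' : t_structure C) : aisle T = aisle T' -> T = T'.
Proof.
move=> e; have e' : coaisle T = coaisle T' by rewrite !coaisleE e.
case: T T' e e' => X Y tp su [X' Y' tp' su'] /= e e'.
rewrite -{}e -{}e' in tp' su' *.
by rewrite (Prop_irrelevance tp tp') (Prop_irrelevance su su').
Qed.

(** * Subcategories with prescribed ends *)

Section Ends.
Variable P : set (plane R).
Hypothesis P_succ : forall a, Z a -> ~ P a -> ~ P (sc a).

(* {a^-, a^+} crosses exactly the arcs that end at [a]. *)
Definition avoid : set C :=
  [set B | exists a, [/\ Z a, ~ P a & B = susp (M [set pd a; sc a])]].

Lemma neighbours_arc a : Z a -> arc (pd a) (sc a).
Proof.
move=> Za; have [l Ll] := L_nonempty hZ.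
apply: (@arc_near _ _ hZ l) => //; [exact: Z_pred|exact: Z_succ|].
by rewrite predK //; exact: succ_gt.
Qed.

Lemma neighbours_ccw a s : Z a -> Z s -> ccw (pd a) s (sc a) -> s = a.
Proof.
move=> Za Zs; have [l Ll] := L_nonempty hZ.
have Z1 := Z_pred hZ Za; have Z2 := Z_succ hZ Za.
move=> /(ccw_angL hZ Ll Z1 Zs Z2) h; apply/(angL_inj hZ Ll Zs Za)/eqP.
have := pred_lt hZ Ll Za; have := succ_gt hZ Ll Za.
have := @succ_le _ _ hZ l Ll a s Za Zs; have := @pred_ge _ _ hZ l Ll a s Za Zs.
by rewrite eq_le; move: h; rewrite /cyc3; lra.
Qed.

Lemma avoid_arc s w : arc s w ->
  lperp avoid (M [set s; w]) <-> P s /\ P w.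
Proof.
move=> asw; have [Zs Zw _] := asw.
have half x y : arc x y -> lperp avoid (M [set x; y]) -> P x.
  move=> axy pxy; have [Zx Zy [n1 n2 n3]] := axy; apply: contrapT => nPx.
  have [l Ll] := L_nonempty hZ; have Z1 := Z_pred hZ Zx; have Z2 := Z_succ hZ Zx.
  have lt1 := pred_lt hZ Ll Zx; have lt2 := succ_gt hZ Ll Zx.
  have le1 := @succ_le _ _ hZ l Ll x y Zx Zy.
  have le2 := @pred_ge _ _ hZ l Ll x y Zx Zy.
  have ne1 := angL_neq hZ Ll Zy Z1 n1; have ne2 := angL_neq hZ Ll Zy Zx n2.
  have ne3 := angL_neq hZ Ll Zy Z2 n3.
  have c4 : ccw4 x (sc x) y (pd x).
    by split; apply/(ccw_angL hZ Ll) => //; rewrite /cyc3; lra.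
  have [f [f0 _]] := hom_cross_line hZ hC axy (neighbours_arc Zx) (or_intror c4).
  by apply/f0/pxy; exists x.
split=> [psw|[Ps Pw] B [a [Za nPa ->]] f].
  split; first exact: half asw psw.
  by apply: (half w s (arc_sym hZ asw)); rewrite setUC.
apply: (dcc_hom_ncross hC (arc_M hZ asw) (arc_M hZ (neighbours_arc Za))).
have key x : Z x -> P x -> ~ ccw (pd a) x (sc a).
  by move=> Zx Px /(neighbours_ccw Za Zx) e; apply: nPa; rewrite -e.
case=> [[_ k2 k3 k4]|[k1 k2 k3 k4]]; first by apply: (key w).
exact: (key s).
Qed.

(** Desuspending a test object for [a] gives, up to isomorphism, the test object for a^+; this is
    why the complement of [P] has to be closed under successors. *)
Lemma avoid_susp_closed : susp_closed (lperp avoid).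
Proof.
move=> A pA B [a [Za nPa ->]] f; have [f' <-] := suspm_surj f.
have Za1 := Z_succ hZ Za.
have := susp_arc hZ hC (neighbours_arc Za); rewrite predK //.
move=> /isomorphic_sym [h hiso].
suff -> : f' = 0 by rewrite suspm0.
apply: (iso_neq0r hiso); apply: pA; exists (sc a); split => //.
  exact: P_succ.
by rewrite succK.
Qed.

Lemma avoid_contains (V : set C) : subcategory V -> E V `<=` P -> V `<=` lperp avoid.
Proof.
move=> hV EP A VA; have [I [B [dA aB]]] := arc_decomposition hC A.
have VB := (hV _ _ _ dA).1 VA.
apply/(lperp_subcategory _ dA) => i; have := VB i.
have [s [w [Zs Zw -> n]]] := aB i; have a : arc s w by case: n.
move=> VM; apply/(avoid_arc a); split; apply: EP; first by exists w.
by exists s; split; [exact: arc_sym|rewrite /arcs_in setUC].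
Qed.

Lemma avoid_ends : E (lperp avoid) `<=` P.
Proof. by move=> s [w [a /(avoid_arc a) []]]. Qed.

End Ends.

Lemma ends_succ (T : t_structure C) a : Z a ->
  E (aisle T) (sc a) -> E (aisle T) a.
Proof.
move=> Za Ea; have [l hl] := seg_ex hZ Za; have [_ Ll _] := hl.
exact: (ends_down hZ (aisle_ptolemy T) Ea hl (ltW (succ_gt hZ Ll Za))).
Qed.

Lemma cap_aisle (T T' : t_structure C) :
  exists T'' : t_structure C, aisle T'' = aisle T `&` aisle T'.
Proof.
apply: (cluster_t_structure hZ hC).
- move=> I Y X d; rewrite /setI /= (aisle_subcategory T d).
  rewrite (aisle_subcategory T' d); split=> [[h h'] i|h]; first by split.
  by split=> i; case: (h i).
- move=> X Y W p q r t [h h'] [k k'].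
  by split; [exact: aisle_ext_closed t h k|exact: aisle_ext_closed t h' k'].
- by move=> X [h h']; split; exact: aisle_susp_closed.
- apply: (crosses_limits_cap hZ); [exact: aisle_ptolemy|exact: aisle_ptolemy|..];
    exact: aisle_crosses_limits.
Qed.

(* The join is the intersection of all larger aisles.  Infinite intersections
   of aisles are not aisles in general: here the aisle of all objects without
   ends outside those of [T] and [T'] bounds the ends of the intersection. *)
Lemma join_aisle (T T' : t_structure C) : exists J : t_structure C,
  aisle J = \bigcap_(S in [set S | aisle T `<=` aisle S /\ aisle T' `<=` aisle S])
    aisle S.
Proof.
pose P := E (aisle T) `|` E (aisle T').
have P_succ a : Z a -> ~ P a -> ~ P (sc a).
  by move=> Za nPa [] /(ends_succ Za) h; apply: nPa; [left|right].
have crossP (V : set C) : E V `<=` P -> aisle T `<=` V -> aisle T' `<=` V ->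
    crosses_limits Z (arcs_in V).
  move=> EP TV TV' q Lq aE.
  have aP : adh_left P q.
    by move=> p cp pq; have [z /EP Pz pzq] := aE p cp pq; exists z.
  have [||h|h] := adh_left_cup hZ _ _ Lq aP; [by move=> z /ends_Z..| |].
    have [s [s' [h1 h2 h3 h4]]] := aisle_crosses_limits Lq h.
    by exists s, s'; split => //; apply: TV.
  have [s [s' [h1 h2 h3 h4]]] := aisle_crosses_limits Lq h.
  by exists s, s'; split => //; apply: TV'.
have TW : aisle T `<=` lperp (avoid P).
  by apply: (avoid_contains (aisle_subcategory T)) => z; left.
have TW' : aisle T' `<=` lperp (avoid P).
  by apply: (avoid_contains (aisle_subcategory T')) => z; right.
have [W WE] : exists W : t_structure C, aisle W = lperp (avoid P).
  apply: (cluster_t_structure hZ hC).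
  - exact: lperp_subcategory.
  - exact: lperp_ext_closed.
  - exact: avoid_susp_closed.
  - by apply: crossP => //; exact: avoid_ends.
apply: (cluster_t_structure hZ hC).
- move=> I Y X d; split=> [h i S hS|h S hS].
    exact: ((aisle_subcategory S d).1 (h S hS)).
  by apply/(aisle_subcategory S d) => i; exact: h.
- move=> X Y Q p q r t h k S hS.
  by apply: (aisle_ext_closed t); [exact: h|exact: k].
- by move=> X h S hS; apply: aisle_susp_closed; exact: h.
- apply: crossP => [z [w [a h]]|A TA S [TS _]|A TA S [_ TS]]; last 2 first.
  + exact: TS.
  + exact: TS.
  apply: avoid_ends; exists w; split => //; rewrite -[lperp _]WE.
  by apply: h; rewrite /= WE.
Qed.

End ClusterTStructures.

Theorem theorem1p2 (K : fieldType) (R : realType) (Z : set (plane R))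
    (hZ : admissible Z) (C : triangulated_category K)
    (M : set (plane R) -> C) (hC : discrete_cluster_category Z M) :
  is_lattice (@t_structure_le K C) /\
  forall T T' : t_structure C, exists T'' : t_structure C,
    is_meet (@t_structure_le K C) T T' T'' /\
    aisle T'' = aisle T `&` aisle T'.
Proof.
have meet T T' : exists T'' : t_structure C,
    is_meet (@t_structure_le K C) T T' T'' /\ aisle T'' = aisle T `&` aisle T'.
  have [S SE] := cap_aisle hZ hC T T'; exists S; split => //.
  rewrite /is_meet /t_structure_le SE; split=> [A []|A []|Q QT QT' A QA] //.
  by split; [exact: QT|exact: QT'].
split => //; split.
- split=> [T|T T' h h'|T T' T'' h h' A TA].
  + exact: subset_refl.
  + by apply: t_structure_eq; apply/seteqP.
  + exact/h'/h.
- by move=> T T'; have [S [h _]] := meet T T'; exists S.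
- move=> T T'; have [J JE] := join_aisle hZ hC T T'; exists J.
  rewrite /is_join /t_structure_le JE; split=> [A TA S []|A TA S []|S TS TS' A].
  + by move=> h _; exact: h.
  + by move=> _ h; exact: h.
  + by apply.
Qed.
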